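(* Let $\theta_0=(\xi_0,\rho_0,\Gamma_0)\in\Theta_m$ with $\xi_0\ne\rho_0$. Then there exists some $c>0$ in the model selection prior $\lambda_n(m)\propto\exp(-c\,m\log(en))$, $m\in\mathbb N$, and constants $C_1,C_2>0$ depending on $\xi_0,\rho_0,\eta$, such that for $n$ large enough, $$P_{\theta_0}^{(n)}\Pi_n\Big(\Gamma:\lambda(\Gamma\Delta\Gamma_0)>C_1\frac{m\log n}{n}\,\Big|\,(X^{(n)},Y^{(n)})\Big)\le C_2e^{-m\log n/C_2}.$$
   Context: Observations $\{(X_i,Y_i)\}_{i=1}^n$: $X_i$ are i.i.d. uniform on $[0,1]^2$, and given $X_i$, $Y_i\sim\mathrm{Bern}(\xi_0)$ if $X_i\in\Gamma_0$ and $Y_i\sim\mathrm{Bern}(\rho_0)$ if $X_i\notin\Gamma_0$, independently over $i$. $P_{\theta_0}^{(n)}$ is expectation under $\theta_0=(\xi_0,\rho_0,\Gamma_0)$. $\lambda(\cdot)$ applied to sets is Lebesgue measure on $[0,1]^2$ and $\Delta$ is symmetric difference. Fix $\eta\in(0,1/2)$. $\mathscr C_m$ is the set of all convex polytopes in $[\eta,1-\eta]^2$ with at most $m$ vertices, and $\Theta_m=\{(\xi,\rho,\Gamma):\xi,\rho\in[\eta,1-\eta],\ \xi\ne\rho,\ \Gamma\in\mathscr C_m\}$. Prior: draw $m$ from $\lambda_n$; given $m$, draw $(\xi,\rho,\Gamma)$ from a product prior in which $\xi$ and $\rho$ are uniform on $[\eta,1-\eta]$ and $\Gamma$ is the convex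 hull of $m$ points drawn independently and uniformly from $[\eta,1-\eta]^2$. $\Pi_n(\cdot\mid(X^{(n)},Y^{(n)}))$ is the resulting posterior. *)

(* Defs.v *)
From HB Require Import structures.
From mathcomp Require Import all_boot all_order all_algebra.
From mathcomp Require Import all_classical all_reals all_analysis.

Set Implicit Arguments.
Unset Strict Implicit.
Unset Printing Implicit Defensive.
Import Order.TTheory GRing.Theory Num.Theory.
Import numFieldNormedType.Exports.

Local Open Scope classical_set_scope.
Local Open Scope ring_scope.
Local Open Scope convex_scope.
Local Open Scope card_scope.

Notation plane R := (measurableTypeR R * measurableTypeR R)%type.

(* Law of n independent draws from P, built by prepending one draw to n. *)
Section iid_law.
Context d (T : measurableType d) (R : realType) (P : probability T R).

Definition tuple_cons n (z : T * n.-tuple T) : n.+1.-tuple T :=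
  [tuple of z.1 :: z.2].

Lemma measurable_tuple_cons n : measurable_fun setT (@tuple_cons n).
Proof. exact: measurable_cons. Qed.

HB.instance Definition _ n :=
  isMeasurableFun.Build _ _ _ _ (@tuple_cons n) (@measurable_tuple_cons n).

Fixpoint iid n : probability (n.-tuple T) R :=
  match n with
  | 0 => \d_[tuple]
  | k.+1 => distribution (P \x iid k)%E (@tuple_cons k)
  end.

End iid_law.

Section planar_geometry.
Context (R : realType).
Implicit Types (A G : set (plane R)).

Definition area : set (plane R) -> \bar R :=
  (@lebesgue_measure R \x @lebesgue_measure R)%E.

Definition uniform_square (a b : R) (ab : a < b) : probability (plane R) R :=
  (uniform_prob ab \x uniform_prob ab)%E.

Definition convex_plane : set (set (plane R)) :=
  fun A => @convex_set R (R^o * R^o)%type A.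

Definition hull A : set (plane R) := smallest convex_plane A.

Definition polytope G := exists s : seq (plane R), G = hull [set` s].

Definition vertices G : set (plane R) :=
  [set v | G v /\ forall (a b : convex_lmodType (R^o * R^o)%type) (t : {i01 R}),
     G a -> G b -> 0 < t%:num < 1 -> v = a <| t |> b -> a = v /\ b = v].

Definition polytopes (eta : R) (m : nat) : set (set (plane R)) :=
  [set G | [/\ polytope G,
     G `<=` `[eta, 1 - eta] `*` `[eta, 1 - eta] & vertices G #<= `I_m]].

End planar_geometry.

Section model.
Context (R : realType).

(* A parameter (xi, rho, Gamma). *)
Definition param : Type := (R * R * set (plane R))%type.

Definition Theta (eta : R) (m : nat) : set param :=
  [set th | [/\ th.1.1 \in `[eta, 1 - eta], th.1.2 \in `[eta, 1 - eta],
     th.1.1 != th.1.2 & polytopes eta m th.2]].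

Definition success (th : param) (x : plane R) : R :=
  if x \in th.2 then th.1.1 else th.1.2.

(* Density of (X^n, Y^n) with respect to (uniform law of X^n) x counting;
   equivalently the conditional mass function of Y^n given X^n. *)
Definition likelihood (th : param) n
    (x : n.-tuple (plane R)) (y : n.-tuple bool) : R :=
  \prod_(i < n) bernoulli_pmf (success th (tnth x i)) (tnth y i).

Definition expect (th : param) n
    (f : n.-tuple (plane R) -> n.-tuple bool -> R) : \bar R :=
  (\int[iid (uniform_square (@ltr01 R)) n]_x
     (\sum_(y : n.-tuple bool) likelihood th x y * f x y)%R%:E)%E.

Definition model_weight (c : R) (n m : nat) : R :=
  expR (- (c * m%:R * ln (expR 1 * n%:R))).

(* Normalized over m = 1, 2, 3, ... *)
Definition model_prior (c : R) (n m : nat) : R :=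
  model_weight c n m / fine (\sum_(1 <= k <oo) (model_weight c n k)%:E)%E.

Lemma eta_lt (eta : R) : 0 < eta < 1 / 2 -> eta < 1 - eta.
Proof.
by move=> /andP[_ h]; rewrite ltrBrDr -mulr2n -mulr_natr -ltr_pdivlMr.
Qed.

Section prior_posterior.
Context (eta : R) (heta : 0 < eta < 1 / 2) (c : R) (n : nat).

Definition draw_param k (w : (R * R) * k.-tuple (plane R)) : param :=
  (w.1, hull [set` w.2]).

(* Law of (xi, rho) together with the k points spanning Gamma. *)
Definition draw_law k :
    probability ((measurableTypeR R * measurableTypeR R) *
                 k.-tuple (plane R))%type R :=
  (uniform_square (eta_lt heta) \x iid (uniform_square (eta_lt heta)) k)%E.

(* \int_D g dPi for the hierarchical prior Pi. *)
Definition prior_integral (D : set param) (g : param -> R) : \bar R :=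
  (\sum_(1 <= k <oo) (model_prior c n k)%:E *
     \int[draw_law k]_(w in [set w | D (draw_param w)])
       (g (draw_param w))%:E)%E.

Definition posterior (D : set param)
    (x : n.-tuple (plane R)) (y : n.-tuple bool) : R :=
  fine (prior_integral D (fun th => likelihood th x y)) /
  fine (prior_integral setT (fun th => likelihood th x y)).

End prior_posterior.

End model.

(* Main.v *)
From HB Require Import structures.
Require Import Defs.
From mathcomp Require Import all_boot all_order all_algebra finmap.
From mathcomp Require Import all_classical all_reals all_analysis.
From mathcomp Require Import measurable_realfun ring lra.

(** The posterior mass of the far sets is a sum, over the number [k] of points
    spanning the hull, of ratios [N_k / D]: [D] is the marginal likelihood and
    [N_k] the part of it carried by far hulls of [k] points.  Numerators and
    denominator are compared with the likelihood at the truth by cutting the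
    prior into cells: [[eta, 1 - eta]] is divided into [n ^ 2] intervals, and a
    cell fixes the interval of [xi], of [rho] and of each coordinate of each
    vertex.  When the vertices move within a cell, membership in the hull
    changes only in thin strips along the lines through two vertices
    ([hull_perturb]).  So within a cell the likelihood is constant up to a
    product over the observations of factors [1 + O(1 / n ^ 2)], times [1 / eta]
    for an observation in a strip ([likelihood_cell], [likelihood_base]).

    Since [N_k / D <= 1], this ratio is at most its square root, hence at most
    the sum over the far cells of the square roots of their shares
    ([post_term_le], [ler_sqrt_sum]).  Under the truth the expectation of such a
    square root factorizes over the observations into the [n]-th power of a
    Hellinger affinity, slightly enlarged by the strips ([sum_sqrt_ratio],
    [integral_majorant_prod]).  This replaces both the tests and the
    concentration bound on [D] of the usual argument.  The affinity is at most
    [1 - r * min (area (G + G0), area G0)] with [r] depending on [xi0], [rho0]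
    and [eta] only ([hellinger_le], [discriminate]): all sets stay in
    [[eta, 1 - eta]^2], so the outer band identifies [rho]; once [rho] is close
    to [rho0], either [xi] is away from [rho0] and the whole of [G + G0] is
    misjudged, or both rates are close to [rho0] and all of [G0] is.

    It remains to compare exponents.  Let [L = ln (e n)] and let [s] be the
    least number of points whose hulls approximate [G0] to any accuracy; [s] is
    at most [m] since a polytope is the hull of its extreme points
    ([polytope_tuple]).  Bounding [D] from below by one cell around a good
    [s]-point hull, the contribution of [k] points is at most
    [exp (L (c / 2 (s - k) + 5 (k + s)) - n r delta)], [delta] being the above
    minimum ([tail_le_exponent]).  With [c = 40 (m + 1)] and
    [C1 = 36 / r] this is at most [exp (- (m + k) L)] in each of four cases:
    - [2 m <= k]: the model prior is small enough ([exponent_many]);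
    - [s <= k < 2 m]: [n r delta] exceeds [36 m ln n] ([exponent_middle]);
    - [k < s]: hulls of [k] points stay at a fixed distance from [G0], so
      [n r delta] is linear in [n] ([exponent_few]);
    - [area G0 = 0]: then [s = 1], while a far hull has positive area, hence at
      least three points, and the model prior decides ([exponent_degenerate]).
    In the last case the sampling law carries no information on the hull, and
    only a prior exponent [c] growing with [m] gives the rate. *)

Set Implicit Arguments.
Unset Strict Implicit.
Unset Printing Implicit Defensive.
Import Order.TTheory GRing.Theory Num.Theory.
Import numFieldNormedType.Exports.

Local Open Scope classical_set_scope.
Local Open Scope ring_scope.


(** * Convex hulls of finite planar sets *)
Section Convexity.
Context {R : realType}.
Implicit Types (p q x : plane R) (A C : set (plane R)) (t : R).

Definition px p : R := p.1.
Definition py p : R := p.2.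

Definition mix t p q : plane R :=
  (t * px p + (1 - t) * px q, t * py p + (1 - t) * py q).

Lemma px_mix t p q : px (mix t p q) = t * px p + (1 - t) * px q.
Proof. by []. Qed.

Lemma py_mix t p q : py (mix t p q) = t * py p + (1 - t) * py q.
Proof. by []. Qed.

Lemma planeP p q : px p = px q -> py p = py q -> p = q.
Proof. by case: p q => [a b] [c d] /=; rewrite /px /py /= => -> ->. Qed.

Lemma mix0 p q : mix 0 p q = q.
Proof. by apply: planeP; rewrite !(px_mix, py_mix); ring. Qed.

Lemma mix1 p q : mix 1 p q = p.
Proof. by apply: planeP; rewrite !(px_mix, py_mix); ring. Qed.

Lemma convE p q (t : {i01 R}) :
  @conv R (convex_lmodType (R^o * R^o)%type) t p q = mix t%:num p q.
Proof. by []. Qed.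

Lemma convex_planeP A : convex_plane A <->
  forall p q t, 0 <= t -> t <= 1 -> A p -> A q -> A (mix t p q).
Proof.
split=> [cA p q t t0 t1 Ap Aq|cA p q t /set_mem Ap /set_mem Aq].
  by have /set_mem := cA p q (Itv01 t0 t1) (mem_set Ap) (mem_set Aq).
by apply/mem_set; apply: cA.
Qed.

Lemma hull_sub A : A `<=` hull A.
Proof. exact: sub_smallest. Qed.

Lemma hull_min A C : convex_plane C -> A `<=` C -> hull A `<=` C.
Proof. exact: smallest_sub. Qed.

Lemma convex_hull A : convex_plane (hull A).
Proof.
apply/convex_planeP => p q t t0 t1 Ap Aq C [cC AC].
by move/convex_planeP : (cC); apply => //; [apply: Ap|apply: Aq].
Qed.

Arguments convex_hull : clear implicits.

Lemma hull_mix A p q t : 0 <= t -> t <= 1 -> hull A p -> hull A q ->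
  hull A (mix t p q).
Proof. by move=> t0 t1; have /convex_planeP := convex_hull A; exact. Qed.

Lemma hull_mono A C : A `<=` C -> hull A `<=` hull C.
Proof. by move=> AC; apply: hull_min => [|x /AC]; [exact: convex_hull|exact: hull_sub]. Qed.

Lemma hull0 : hull set0 = set0 :> set (plane R).
Proof.
by rewrite -subset0; apply: hull_min => //; apply/convex_planeP.
Qed.

Lemma hull1 p : hull [set p] = [set p].
Proof.
apply/seteqP; split; last exact: hull_sub.
apply: hull_min => //; apply/convex_planeP => _ _ t _ _ -> ->.
by apply: planeP; rewrite /= ?px_mix ?py_mix; ring.
Qed.

(** The hull of [p |: A] when [A] is convex and nonempty: the union of the
    segments from [p] to the points of [A]. *)
Definition join p A : set (plane R) :=
  [set x | exists t q, [/\ 0 <= t, t <= 1, A q & x = mix t p q]].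

Lemma convex_join p A : convex_plane A -> convex_plane (join p A).
Proof.
move=> /convex_planeP cA; apply/convex_planeP.
move=> _ _ t t0 t1 [a [u [a0 a1 Au ->]]] [b [v [b0 b1 Av ->]]].
(* The weight on [A] of the combination; when it vanishes the point is [p]. *)
have [s0|s0] := eqVneq (t * (1 - a) + (1 - t) * (1 - b)) 0.
  exists 1, u; split => //.
  have h1 : t * (1 - a) = 0 by nra.
  have h2 : (1 - t) * (1 - b) = 0 by lra.
  have ta : t * a = t by lra.
  have tb : (1 - t) * b = 1 - t by lra.
  apply: planeP; rewrite !(px_mix, py_mix) !mulrDr !mulrA ta tb h1 h2; ring.
have s1 : 0 < t * (1 - a) + (1 - t) * (1 - b) by rewrite lt_neqAle eq_sym s0; nra.
set s := _ + _ in s0 s1.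
exists (1 - s), (mix (t * (1 - a) / s) u v); split.
- by rewrite /s; nra.
- by rewrite gerBl ltW.
- apply: cA => //; first by rewrite divr_ge0//; nra.
  by rewrite ler_pdivrMr// mul1r /s; nra.
- by apply: planeP; rewrite !(px_mix, py_mix) /s; field.
Qed.

Lemma hull_cons p (s : seq (plane R)) : s != [::] ->
  hull [set` p :: s] = join p (hull [set` s]).
Proof.
move=> s0; apply/seteqP; split.
  apply: hull_min; first exact/convex_join/convex_hull.
  move=> x /=; rewrite inE => /orP[/eqP ->|xs].
    case: s s0 => // q s _; exists 1, q; rewrite mix1; split => //.
    by apply: hull_sub; rewrite /= inE eqxx.
  by exists 0, x; rewrite mix0; split => //; exact: hull_sub.
move=> x [t [q [t0 t1 sq ->]]]; apply: hull_mix => //.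
  by apply: hull_sub; rewrite /= inE eqxx.
by apply: hull_mono sq => y /= ys; rewrite inE ys orbT.
Qed.

(** A cone over a compact set is the continuous image of its product with
    [[0, 1]]; adding the generators one at a time exhausts the hull. *)
Lemma compact_hull (s : seq (plane R)) :
  @compact (R * R)%type (hull [set` s]).
Proof.
elim: s => [|p [|q s] IH].
- have -> : [set` [::]] = set0 :> set (plane R) by apply/seteqP; split.
  by rewrite hull0; exact: compact0.
- have -> : [set` [:: p]] = [set p].
    by apply/seteqP; split => x /=; rewrite inE => /eqP.
  by rewrite hull1; exact: compact_set1.
rewrite hull_cons//.
pose f (z : R * (R * R)) : R * R := mix z.1 p z.2.
have -> : join p (hull [set` q :: s]) =
    f @` (`[0, 1] `*` (hull [set` q :: s])).
  apply/seteqP; split.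
    move=> x [t [y [t0 t1 sy ->]]]; exists (t, y) => //.
    by split => //=; rewrite in_itv/= t0 t1.
  move=> _ [[t y] [/= + sy] <-]; rewrite in_itv/= => /andP[t0 t1].
  by exists t, y.
apply: continuous_compact; last by apply: compact_setX => //; exact: segment_compact.
apply: continuous_subspaceT => z.
have c1 : (fun w : R * (R * R) => w.1) @ z --> z.1 by exact: cvg_fst.
have c2 : (fun w : R * (R * R) => w.2.1) @ z --> z.2.1.
  by apply: (@cvg_comp _ _ _ snd fst); [exact: cvg_snd|exact: cvg_fst].
have c3 : (fun w : R * (R * R) => w.2.2) @ z --> z.2.2.
  by apply: (@cvg_comp _ _ _ snd snd); [exact: cvg_snd|exact: cvg_snd].
have d1 : (fun w : R * (R * R) => (f w).1) @ z --> (f z).1.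
  by apply: cvgD; apply: cvgM => //; try exact: cvg_cst; apply: cvgB => //;
    exact: cvg_cst.
have d2 : (fun w : R * (R * R) => (f w).2) @ z --> (f z).2.
  by apply: cvgD; apply: cvgM => //; try exact: cvg_cst; apply: cvgB => //;
    exact: cvg_cst.
exact: (cvg_pair d1 d2).
Qed.

Definition sqdist p q : R := (px p - px q) ^+ 2 + (py p - py q) ^+ 2.

Lemma closest_point (s : seq (plane R)) x : hull [set` s] !=set0 ->
  exists2 p, hull [set` s] p &
    forall q, hull [set` s] q -> sqdist x p <= sqdist x q.
Proof.
move=> s0.
have [| | |p ps pP] := @compact_EVT_min (R * R)%type R (sqdist x : R * R -> R)
  (hull [set` s]).
- exact: s0.
- exact: compact_hull.
- apply: continuous_subspaceT => z; apply: cvgD; apply: cvgM;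
    apply: cvgB; try exact: cvg_cst; rewrite /px /py;
    try exact: cvg_fst; exact: cvg_snd.
- by exists p; [exact/set_mem|move=> q sq; apply: pP; exact/mem_set].
Qed.

End Convexity.

(** * Separation and faces *)
Section Separation.
Context {R : realType}.
Implicit Types (p q x u v : plane R) (A C : set (plane R)) (t c h : R).

Definition dot u x : R := px u * px x + py u * py x.

Lemma dot_mix u t p q : dot u (mix t p q) = t * dot u p + (1 - t) * dot u q.
Proof. by rewrite /dot px_mix py_mix; ring. Qed.

(** Half-planes are convex, so a linear bound on the generators passes to the
    hull. *)
Lemma hull_dot_le A u c : (forall q, A q -> dot u q <= c) ->
  forall x, hull A x -> dot u x <= c.
Proof.
move=> Ac; apply: (@hull_min R A [set x | dot u x <= c]) => //.
by apply/convex_planeP => p q t t0 t1 /= pc qc; rewrite dot_mix; nra.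
Qed.

Lemma hull_dot_lt A u c : (forall q, A q -> dot u q < c) ->
  forall x, hull A x -> dot u x < c.
Proof.
move=> Ac; apply: (@hull_min R A [set x | dot u x < c]) => //.
apply/convex_planeP => p q t t0 t1 /= pc qc; rewrite dot_mix.
by have [t2|t2] := leP t (1 / 2); nra.
Qed.

(** The points of the hull on a supporting line come from the generators on that
    line: being either strictly below the line or in the hull of the generators
    on it is a convex condition. *)
Lemma hull_face A u c x : (forall q, A q -> dot u q <= c) ->
  hull A x -> dot u x = c -> hull (A `&` [set q | dot u q = c]) x.
Proof.
move=> Ac Ax xc.
pose F := hull (A `&` [set q | dot u q = c]).
have Fc y : F y -> dot u y <= c by apply: hull_dot_le => q [/Ac].
suff : (A `<=` hull A) /\ hull A `<=` [set y | dot u y < c \/ F y].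
  by move=> [_ /(_ x Ax)[|//]]; rewrite xc ltxx.
split; first exact: hull_sub.
apply: hull_min => [|q Aq]; last first.
  have := Ac _ Aq; rewrite le_eqVlt => /orP[/eqP qc|]; last by left.
  by right; apply: hull_sub.
apply/convex_planeP => p q t t0 t1 /= pP qP.
have pc : dot u p <= c by case: pP => [/ltW //|/Fc].
have qc : dot u q <= c by case: qP => [/ltW //|/Fc].
have [->|tn0] := eqVneq t 0; first by rewrite mix0.
have [->|tn1] := eqVneq t 1; first by rewrite mix1.
have t0' : 0 < t by rewrite lt_neqAle eq_sym tn0.
have t1' : t < 1 by rewrite lt_neqAle tn1.
rewrite dot_mix; case: pP => [plt|Fp]; first by left; nra.
case: qP => [qlt|Fq]; first by left; nra.
by right; apply: hull_mix.
Qed.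

(** The variational inequality of a metric projection: moving from [p] towards
    any point of the hull cannot decrease the distance to [x] to first order. *)
Lemma closest_point_dot A p x : hull A p ->
  (forall q, hull A q -> sqdist x p <= sqdist x q) ->
  forall u, u = (px x - px p, py x - py p) ->
  forall q, hull A q -> dot u q <= dot u p.
Proof.
move=> Ap pmin u uE q Aq.
set g := dot u q - dot u p; rewrite -subr_le0 -/g leNgt; apply/negP => g0.
set D := sqdist p q.
have key t : 0 <= t -> t <= 1 -> 2 * t * g <= t ^+ 2 * D.
  move=> t0 t1; have := pmin _ (hull_mix t0 t1 Aq Ap).
  rewrite -subr_ge0.
  suff -> : sqdist x (mix t q p) - sqdist x p = t ^+ 2 * D - 2 * t * g.
    by rewrite subr_ge0.
  by rewrite /sqdist /D /g /dot uE /sqdist px_mix py_mix /px /py /=; ring.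
have D0 : 0 <= D by rewrite addr_ge0// sqr_ge0.
(* At this [t] the linear term of [key] exceeds the quadratic one. *)
have gD : g / (g + D) <= 1 by rewrite ler_pdivrMr; lra.
have gD0 : 0 < g / (g + D) by rewrite divr_gt0//; lra.
have tD : g / (g + D) * (g + D) = g by rewrite divfK// gt_eqF//; lra.
move: (g / (g + D)) gD gD0 tD => t t1 t0 tD.
have := key _ (ltW t0) t1.
suff : 0 < t * (t * g + g) by nra.
by rewrite mulr_gt0// addr_gt0// mulr_gt0.
Qed.

Lemma segment_cross u p q c : dot u p <= c -> c <= dot u q ->
  exists2 t, 0 <= t <= 1 & dot u (mix t p q) = c.
Proof.
move=> pc cq; have [e|ne] := eqVneq (dot u p) (dot u q).
  by exists 0; [rewrite lexx ler01|rewrite dot_mix; lra].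
have lt : 0 < dot u q - dot u p by rewrite subr_gt0 lt_neqAle ne; lra.
exists ((dot u q - c) / (dot u q - dot u p)).
  by rewrite divr_ge0 ?ler_pdivrMr//=; lra.
by rewrite dot_mix; field; rewrite gt_eqF.
Qed.

Lemma seq_argmax (s : seq (plane R)) (f : plane R -> R) : s != [::] ->
  exists2 p, p \in s & forall q, q \in s -> f q <= f p.
Proof.
elim: s => // a [|b s] IH _.
  by exists a; [rewrite inE|move=> q; rewrite inE => /eqP ->].
have [p ps pP] := IH isT.
have [ap|pa] := leP (f a) (f p).
  by exists p; [rewrite inE ps orbT|move=> q; rewrite inE => /orP[/eqP->//|/pP]].
exists a; [by rewrite inE eqxx|move=> q; rewrite inE => /orP[/eqP->//|/pP qp]].
exact: le_trans qp (ltW pa).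
Qed.

(** Collinear generators span the segment between their two extremes, found by
    maximizing and minimizing a coordinate along the line. *)
Lemma collinear_hull (s : seq (plane R)) u c x : dot u u != 0 ->
  (forall q, q \in s -> dot u q = c) -> hull [set` s] x ->
  exists a b t, [/\ a \in s, b \in s, 0 <= t <= 1 & x = mix t a b].
Proof.
move=> u0 sc sx.
have s0 : s != [::].
  apply/eqP => s0; move: sx; rewrite s0.
  rewrite (_ : [set` [::]] = set0) ?hull0//; by apply/seteqP; split.
pose v : plane R := (- py u, px u).
have [b bs bP] := seq_argmax (dot v) s0.
have [a as_ aP] := seq_argmax (fun q => - dot v q) s0.
have xb : dot v x <= dot v b by apply: hull_dot_le sx => q /bP.
have ax : dot v a <= dot v x.
  rewrite -lerN2.
  have dN y : dot (- px v, - py v) y = - dot v y.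
    by rewrite /dot /px /py /=; ring.
  by rewrite -dN; apply: (hull_dot_le _ sx) => q /aP; rewrite dN.
have [t /andP[t0 t1] tE] := segment_cross ax xb.
exists a, b, t; split=> //; first by rewrite t0.
have mc : dot u (mix t a b) = c by rewrite dot_mix (sc _ as_) (sc _ bs); ring.
have xc : dot u x = c.
  apply/eqP; rewrite eq_le (@hull_dot_le [set` s])//=; last by move=> q /sc ->.
  rewrite -lerN2.
  have dN y : dot (- px u, - py u) y = - dot u y.
    by rewrite /dot /px /py /=; ring.
  by rewrite -dN (hull_dot_le _ sx)// => q /sc; rewrite dN => ->.
have dv y : dot v y = - py u * px y + px u * py y by [].
have px_of y : dot u u * px y = px u * dot u y - py u * dot v y.
  by rewrite dv /dot; ring.
have py_of y : dot u u * py y = py u * dot u y + px u * dot v y.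
  by rewrite dv /dot; ring.
by apply: planeP; apply: (mulfI u0); rewrite ?px_of ?py_of xc mc tE.
Qed.

(** The projection of an outside point lies on the supporting line orthogonal to
    the projecting direction, hence on a segment joining two generators.  This is
    what confines the effect of a perturbation to neighbourhoods of such
    segments. *)
Lemma closest_point_edge (s : seq (plane R)) p x :
  hull [set` s] p -> ~ hull [set` s] x ->
  (forall q, hull [set` s] q -> sqdist x p <= sqdist x q) ->
  exists a b t, [/\ a \in s, b \in s, 0 <= t <= 1 & p = mix t a b].
Proof.
move=> sp nsx pmin; pose u : plane R := (px x - px p, py x - py p).
have up := closest_point_dot sp pmin (erefl u).
have := @hull_face [set` s] u (dot u p) p.
have uq q : [set` s] q -> dot u q <= dot u p by move=> /hull_sub /up.
move=> /(_ uq sp erefl).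
pose s' := [seq q <- s | dot u q == dot u p].
have -> : [set` s] `&` [set q | dot u q = dot u p] = [set` s'].
  apply/seteqP; split => q /=; rewrite mem_filter.
    by move=> [-> ->]; rewrite eqxx.
  by move=> /andP[/eqP -> ->].
have u0 : dot u u != 0.
  apply/eqP; rewrite /dot /= => /eqP.
  rewrite paddr_eq0 -?expr2 ?sqr_ge0// !sqrf_eq0 /u /px /py /=.
  rewrite !subr_eq0 => /andP[/eqP e1 /eqP e2].
  by apply: nsx; have -> : x = p by exact: planeP.
move=> s'p.
have [q|a [b [t [a1 b1 t01 e]]]] := @collinear_hull s' u (dot u p) p u0 _ s'p.
  by rewrite mem_filter => /andP[/eqP].
exists a, b, t; split => //.
  by move: a1; rewrite mem_filter => /andP[].
by move: b1; rewrite mem_filter => /andP[].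
Qed.

(** The direction from the projection of [x] to [x] separates strictly. *)
Lemma separation (s : seq (plane R)) x : ~ hull [set` s] x ->
  exists u, forall q, q \in s -> dot u q < dot u x.
Proof.
move=> nsx.
have [->|s0] := eqVneq s [::]; first by exists x.
have [|p sp pmin] := @closest_point R s x.
  by case: s s0 {nsx} => // q s _; exists q; apply: hull_sub; rewrite /= inE eqxx.
pose u : plane R := (px x - px p, py x - py p).
have up := closest_point_dot sp pmin (erefl u).
exists u => q qs; apply: le_lt_trans (up q _) _; first exact: hull_sub.
have : ~~ ((px x == px p) && (py x == py p)).
  by apply/negP => /andP[/eqP e1 /eqP e2]; apply: nsx; rewrite (planeP e1 e2).
rewrite -subr_gt0 => ne.
have -> : dot u x - dot u p = (px x - px p) ^+ 2 + (py x - py p) ^+ 2.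
  by rewrite /dot /u /px /py /=; ring.
rewrite lt_neqAle addr_ge0 ?sqr_ge0// andbT eq_sym.
by rewrite paddr_eq0 ?sqr_ge0// !sqrf_eq0 !subr_eq0.
Qed.

End Separation.

(** * Hulls under perturbation of their vertices *)
Section Perturbation.
Context {R : realType}.
Implicit Types (p q x u v a b : plane R) (t c h e : R).

Definition near_pt h p q := `|px p - px q| <= h /\ `|py p - py q| <= h.

Lemma near_ptC h p q : near_pt h p q -> near_pt h q p.
Proof. by rewrite /near_pt distrC (distrC (py p)). Qed.

Lemma convex_dist (t s s' r r' h : R) : 0 <= t -> t <= 1 ->
  `|s - s'| <= h -> `|r - r'| <= h ->
  `|t * s + (1 - t) * r - (t * s' + (1 - t) * r')| <= h.
Proof. by rewrite !ler_norml => t0 t1 /andP[? ?] /andP[? ?]; nra. Qed.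

Lemma near_mix t h p q p' q' : 0 <= t -> t <= 1 ->
  near_pt h p p' -> near_pt h q q' -> near_pt h (mix t p q) (mix t p' q').
Proof.
by move=> t0 t1 [? ?] [? ?]; split; rewrite !(px_mix, py_mix); apply: convex_dist.
Qed.

(** Moving each generator by at most [h] moves each convex combination by at most
    [h]. *)
Lemma hull_near k (w w' : k.-tuple (plane R)) h x :
  (forall i, near_pt h (tnth w i) (tnth w' i)) -> hull [set` w] x ->
  exists2 x', hull [set` w'] x' & near_pt h x x'.
Proof.
move=> ww'.
apply: (@hull_min _ _ [set x | exists2 x', hull [set` w'] x' & near_pt h x x']).
  apply/convex_planeP => p q t t0 t1 /= [p' p'w pp'] [q' q'w qq'].
  by exists (mix t p' q'); [exact: hull_mix|exact: near_mix].
move=> _ /= /tnthP[i ->]; exists (tnth w' i) => //.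
by apply: hull_sub => /=; exact: mem_tnth.
Qed.

(** Orthogonal to [a - b] and of sup norm one, with a coordinate equal to one, so
    that a strip of half-width [e] meets the lines parallel to some axis in
    segments of length [2 e].  The division by zero when [a = b] returns the
    vector [(0, 1)]. *)
Definition normal a b : plane R :=
  let dx := px a - px b in let dy := py a - py b in
  if `|dy| <= `|dx| then (- (dy / dx), 1) else (1, - (dx / dy)).

Definition sup_unit v :=
  (`|px v| <= 1 /\ py v = 1) \/ (px v = 1 /\ `|py v| <= 1).

Lemma normal_unit a b : sup_unit (normal a b).
Proof.
rewrite /normal; case: ifPn => [dd|].
  left; split => //=; rewrite /px /= normrN normf_div.
  have [->|d0] := eqVneq (px a - px b) 0; first by rewrite normr0 invr0 mulr0.
  by rewrite ler_pdivrMr ?normr_gt0// mul1r.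
rewrite -ltNge => dd; right; split => //=; rewrite /py /= normrN normf_div.
rewrite ler_pdivrMr ?mul1r; first exact: ltW.
exact: le_lt_trans dd.
Qed.

Lemma dot_normal a b : dot (normal a b) a = dot (normal a b) b.
Proof.
apply/eqP; rewrite -subr_eq0; apply/eqP.
have -> u : dot u a - dot u b = px u * (px a - px b) + py u * (py a - py b).
  by rewrite /dot; ring.
rewrite /normal; case: ifPn => [dd|]; rewrite {1}/px {2}/py /=.
  have [d0|d0] := eqVneq (px a - px b) 0; last by field.
  by move: dd; rewrite d0 normr0 normr_le0 => /eqP ->; rewrite !mulr0 addr0.
rewrite -ltNge => dd; field; rewrite -normr_gt0; exact: le_lt_trans dd.
Qed.

Definition strip v a e : set (plane R) := [set x | `|dot v x - dot v a| <= e].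

(** A strip along each line through two vertices.  The half-width [4 * h] absorbs
    two errors of at most [2 * h] in a linear form of sup norm one: the distance
    of a point to its projection on a perturbed hull, and the displacement of the
    edge carrying this projection. *)
Definition edge_strips k (w : k.-tuple (plane R)) h : set (plane R) :=
  \big[setU/set0]_(z : 'I_k * 'I_k)
    strip (normal (tnth w z.1) (tnth w z.2)) (tnth w z.1) (4 * h).

Lemma edge_stripsP k (w : k.-tuple (plane R)) h i j x :
  strip (normal (tnth w i) (tnth w j)) (tnth w i) (4 * h) x ->
  edge_strips w h x.
Proof. by move=> sx; rewrite /edge_strips (bigD1 (i, j))//=; left. Qed.

Lemma sup_unit_le1 v : sup_unit v -> `|px v| <= 1 /\ `|py v| <= 1.
Proof. by case=> [[? ->]|[-> ?]]; rewrite normr1. Qed.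

Lemma dot_near v h p q : sup_unit v -> near_pt h p q ->
  `|dot v p - dot v q| <= 2 * h.
Proof.
move=> v1; have -> : dot v p - dot v q = px v * (px p - px q) + py v * (py p - py q).
  by rewrite /dot; ring.
have [u1 u2] := sup_unit_le1 v1; move=> [n1 n2].
rewrite mulr2n mulrDl mul1r; apply: le_trans (ler_normD _ _) _.
by apply: lerD; rewrite normrM -[leRHS]mul1r; apply: ler_pM.
Qed.

(** A point at sup distance at most [h] is at Euclidean distance at most
    [sqrt 2 * h], and so is any closer point; the Cauchy-Schwarz inequality with
    [px v ^+ 2 + py v ^+ 2 <= 2] gives the bound. *)
Lemma dot_sqdist v h p x x' : sup_unit v -> near_pt h x x' ->
  sqdist x p <= sqdist x x' -> `|dot v x - dot v p| <= 2 * h.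
Proof.
move=> v1 [n1 n2]; have h0 : 0 <= h by exact: le_trans n1.
have -> : dot v x - dot v p = px v * (px x - px p) + py v * (py x - py p).
  by rewrite /dot; ring.
rewrite /sqdist.
move: (px x - px p) (py x - py p) (px x - px x') (py x - py x') n1 n2
  => d1 d2 f1 f2 n1 n2 dd.
have D : d1 ^+ 2 + d2 ^+ 2 <= 2 * h ^+ 2.
  apply: (le_trans dd); rewrite mulr_natl mulr2n.
  by apply: lerD; rewrite -[_ ^+ 2]ger0_norm ?sqr_ge0// normrX lerXn2r ?nnegrE.
have V : px v ^+ 2 + py v ^+ 2 <= 2.
  have [] := sup_unit_le1 v1; rewrite !ler_norml => /andP[? ?] /andP[? ?].
  by nra.
rewrite -ler_sqr ?nnegrE ?mulr_ge0// -normrX ger0_norm ?sqr_ge0//.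
have : (px v * d1 + py v * d2) ^+ 2 <=
    (px v ^+ 2 + py v ^+ 2) * (d1 ^+ 2 + d2 ^+ 2).
  rewrite -subr_ge0.
  suff -> : (px v ^+ 2 + py v ^+ 2) * (d1 ^+ 2 + d2 ^+ 2) -
    (px v * d1 + py v * d2) ^+ 2 = (px v * d2 - py v * d1) ^+ 2.
    exact: sqr_ge0.
  by ring.
move=> /le_trans; apply.
have -> : (2 * h) ^+ 2 = 2 * (2 * h ^+ 2) by ring.
by apply: ler_pM => //; rewrite addr_ge0// sqr_ge0.
Qed.

(** If [x] leaves the hull when the vertices move by [h], it is still within [h]
    of the new hull, and its projection there lies on a segment between two
    vertices. *)
Lemma strip_edge k (w : k.-tuple (plane R)) h (w' : k.-tuple (plane R)) x :
  (forall i, near_pt h (tnth w i) (tnth w' i)) ->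
  hull [set` w] x -> ~ hull [set` w'] x ->
  exists i j p, [/\ forall v, sup_unit v -> `|dot v x - dot v p| <= 2 * h &
    exists2 t, 0 <= t <= 1 & p = mix t (tnth w' i) (tnth w' j)].
Proof.
move=> ww' wx nw'x; have [x' w'x' xx'] := hull_near ww' wx.
have [|p w'p pmin] := @closest_point R w' x; first by exists x'.
have [_ [_ [t [/tnthP[i ->] /tnthP[j ->] t01 pE]]]] :=
  closest_point_edge w'p nw'x pmin.
exists i, j, p; split; last by exists t.
by move=> v v1; apply: dot_sqdist v1 xx' (pmin _ w'x').
Qed.

(** Membership is decided away from the strips: if it differs for [w] and [c],
    then [x] projects on an edge of one of the two hulls at distance [O(h)], and
    the corresponding edges are within [h] of each other. *)
Lemma hull_perturb k (w c : k.-tuple (plane R)) h x :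
  (forall i, near_pt h (tnth w i) (tnth c i)) -> ~ edge_strips c h x ->
  (hull [set` w] x <-> hull [set` c] x).
Proof.
move=> wc nx; split=> Hx; apply: contrapT => nHx; apply: nx.
  have [i [j [p [pP [t /andP[t0 t1] pE]]]]] := strip_edge wc Hx nHx.
  apply: (@edge_stripsP _ _ _ i j); rewrite /strip /=.
  have v1 := normal_unit (tnth c i) (tnth c j).
  have := pP _ v1; rewrite pE dot_mix -dot_normal -mulrDl subrKC mul1r.
  move=> le2; apply: (le_trans le2).
  by have := le_trans (normr_ge0 _) le2; lra.
have cw i : near_pt h (tnth c i) (tnth w i) by exact/near_ptC.
have [i [j [p [pP [t /andP[t0 t1] pE]]]]] := strip_edge cw Hx nHx.
apply: (@edge_stripsP _ _ _ i j); rewrite /strip /=.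
have v1 := normal_unit (tnth c i) (tnth c j).
have xp := pP _ v1.
have pn : near_pt h p (mix t (tnth c i) (tnth c j)) by rewrite pE; apply: near_mix.
have := dot_near v1 pn.
rewrite dot_mix -dot_normal -mulrDl subrKC mul1r.
move: xp; rewrite !ler_norml; lra.
Qed.

End Perturbation.

(** * Measurability of hulls; polytopes and their extreme points *)
Section Measurability.
Context {R : realType}.
Implicit Types (p q x u v a b : plane R) (t c h e : R).

Lemma measurable_px : measurable_fun setT (px : plane R -> R).
Proof. exact: measurable_fst. Qed.

Lemma measurable_py : measurable_fun setT (py : plane R -> R).
Proof. exact: measurable_snd. Qed.

Lemma measurable_dot u : measurable_fun setT (dot u).
Proof.
by apply: measurable_funD; apply: measurable_funM => //;
  [exact: measurable_px|exact: measurable_py].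
Qed.

Lemma measurable_strip v a e : measurable (strip v a e).
Proof.
rewrite (_ : strip v a e = (fun x => `|dot v x - dot v a|) @^-1` `]-oo, e]).
  rewrite -[X in measurable X]setTI; apply: measurableT_comp => //.
  by apply: measurable_funB => //; exact: measurable_dot.
by apply/seteqP; split => x; rewrite /strip /= in_itv.
Qed.

Lemma measurable_edge_strips k (w : k.-tuple (plane R)) h :
  measurable (edge_strips w h).
Proof. by apply: bigsetU_measurable => *; exact: measurable_strip. Qed.

(** Finitely many strict inequalities survive a small change of the direction. *)
Lemma separation_open (s : seq (plane R)) x u :
  (forall q, q \in s -> dot u q < dot u x) ->
  exists2 e, 0 < e & forall v, near_pt e u v ->
    forall q, q \in s -> dot v q < dot v x.
Proof.
elim: s => [_|p s IH H]; first by exists 1.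
have [|e e0 eP] := IH; first by move=> q qs; apply: H; rewrite inE qs orbT.
have gap : 0 < dot u x - dot u p by rewrite subr_gt0 H// inE eqxx.
pose B := `|px x - px p| + `|py x - py p| + 1.
have B0 : 0 < B by rewrite ltr_wpDl// addr_ge0.
pose g := dot u x - dot u p.
exists (Num.min e (g / B / 2)); first by rewrite lt_min e0/= !divr_gt0.
move=> v [n1 n2] q; rewrite inE => /orP[/eqP->|]; last first.
  apply: eP; split; [apply: le_trans n1 _|apply: le_trans n2 _];
    by rewrite ge_min lexx.
have ge2 : Num.min e (g / B / 2) <= g / B / 2 by rewrite ge_min lexx orbT.
have {}n1 := le_trans n1 ge2; have {}n2 := le_trans n2 ge2.
have gB : g / B / 2 * B = g / 2 by field; rewrite gt_eqF.
have m1 : `|px u - px v| * `|px x - px p| <= g / B / 2 * `|px x - px p|.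
  exact: ler_wpM2r.
have m2 : `|py u - py v| * `|py x - py p| <= g / B / 2 * `|py x - py p|.
  exact: ler_wpM2r.
have : `|g - (dot v x - dot v p)| < g.
  have -> : g - (dot v x - dot v p) = (px u - px v) * (px x - px p) +
      (py u - py v) * (py x - py p) by rewrite /g /dot; ring.
  apply: le_lt_trans (ler_normD _ _) _; rewrite !normrM.
  apply: le_lt_trans (lerD m1 m2) _.
  apply: (@le_lt_trans _ _ (g / B / 2 * B)); last by rewrite gB; move: gap; rewrite -/g; lra.
  rewrite -mulrDr; apply: ler_wpM2l; last by rewrite /B lerDl.
  by rewrite !divr_ge0// ltW.
by rewrite ltr_norml -/g => /andP[? ?]; rewrite -subr_gt0; lra.
Qed.

(** Strict separation may be achieved by a rational direction, which makes the
    complement a countable union of finite intersections of half-planes. *)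
Lemma hullCE (s : seq (plane R)) :
  ~` hull [set` s] = \bigcup_(r : rat) \bigcup_(r' : rat)
    [set x | forall q, q \in s -> dot (ratr r, ratr r') q < dot (ratr r, ratr r') x].
Proof.
apply/seteqP; split => x.
  move=> /= /separation[u /separation_open[e e0 eP]].
  have [r rP] : exists r : rat, ratr r \in `]px u - e, px u + e[.
    by have /rat_in_itvoo[r ?] : px u - e < px u + e; [lra|exists r].
  have [r' rP'] : exists r : rat, ratr r \in `]py u - e, py u + e[.
    by have /rat_in_itvoo[r' ?] : py u - e < py u + e; [lra|exists r'].
  exists r => //; exists r' => //=; apply: eP.
  move: rP rP'; rewrite !in_itv/= => /andP[? ?] /andP[? ?].
  by split; [change (`|px u - ratr r| <= e)|change (`|py u - ratr r'| <= e)];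
    rewrite ler_norml; lra.
move=> [r _ [r' _ /= H]] sx.
by have := hull_dot_lt H sx; rewrite ltxx.
Qed.

Lemma measurable_hull (s : seq (plane R)) : measurable (hull [set` s]).
Proof.
rewrite -[hull _]setCK hullCE; apply: measurableC.
apply: bigcupT_measurable_rat => r; apply: bigcupT_measurable_rat => r'.
rewrite (_ : mkset _ = \big[setI/setT]_(q <- s)
  [set x | dot (ratr r, ratr r') q < dot (ratr r, ratr r') x]).
  elim/big_ind : _ => // [A B|q _]; first exact: measurableI.
  set u : plane R := (ratr r, ratr r'); rewrite (_ : mkset _ = dot u @^-1` `]dot u q, +oo[).
    by rewrite -[X in measurable X]setTI; exact: measurable_dot.
  by apply/seteqP; split => x /=; rewrite in_itv/= andbT.
rewrite -bigcap_seq; apply/seteqP; split => x H q; exact: H.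
Qed.

End Measurability.

Section ExtremePoints.
Context {R : realType}.
Implicit Types (p q x v : plane R).

Lemma hull_rem (s : seq (plane R)) v : hull [set` rem v s] v ->
  hull [set` rem v s] = hull [set` s].
Proof.
move=> rv; apply/seteqP; split; first by apply: hull_mono => q /=; exact: mem_rem.
apply: hull_min; first exact: convex_hull.
move=> q /= qs; have [->//|qv] := eqVneq q v.
apply: hull_sub; rewrite /=.
have : q \in v :: rem v s.
  have [vs|vns] := boolP (v \in s); first by rewrite -(perm_mem (perm_to_rem vs)).
  by rewrite inE rem_id// qs orbT.
by rewrite inE (negbTE qv).
Qed.

(** If [v] is not in the hull of the other generators, write the hull as a cone
    with apex [v]: a segment through [v] with an endpoint other than [v] would
    express [v] by the points of the base of the cone. *)
Lemma minimal_extreme (s : seq (plane R)) v :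
  v \in s -> ~ hull [set` rem v s] v -> vertices (hull [set` s]) v.
Proof.
move=> vs nv; split; first exact: hull_sub.
move=> a b t sa sb /andP[t0 t1]; rewrite convE => vE.
(* The cone formula needs a nonempty base. *)
have [s1|sn1] := eqVneq (rem v s) [::].
  have hv : hull [set` s] = [set v].
    rewrite (_ : [set` s] = [set v]) ?hull1//; apply/seteqP.
    split => [q /=|q /= ->//]; rewrite (perm_mem (perm_to_rem vs)) s1.
    by rewrite inE => /eqP.
  by move: sa sb; rewrite hv.
have hE : hull [set` s] = join v (hull [set` rem v s]).
  rewrite -hull_cons//; congr hull; apply/seteqP.
  by split => q /=; rewrite (perm_mem (perm_to_rem vs)).
move: sa sb; rewrite hE => -[x [y [x0 x1 sy aE]]] [x' [y' [x0' x1' sy' bE]]].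
set k := t%:num in t0 t1 vE.
pose c := k * (1 - x) + (1 - k) * (1 - x').
have c0 : 0 <= c by rewrite /c; nra.
have [cz|cn0] := eqVneq c 0.
  have ex : x = 1 by move: cz; rewrite /c; nra.
  have ex' : x' = 1 by move: cz; rewrite /c; nra.
  by rewrite aE bE ex ex' !mix1.
case: nv; have cp : 0 < c by rewrite lt_neqAle eq_sym cn0.
have hm : hull [set` rem v s] (mix (k * (1 - x) / c) y y').
  apply: hull_mix => //; first by rewrite divr_ge0//; nra.
  by rewrite ler_pdivrMr// mul1r /c; nra.
suff vm : v = mix (k * (1 - x) / c) y y' by rewrite -vm in hm.
have mE : 1 - k * (1 - x) / c = (1 - k) * (1 - x') / c.
  by rewrite /c; field; rewrite -/c gt_eqF.
have e1 : c * px v = k * (1 - x) * px y + (1 - k) * (1 - x') * px y'.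
  have := congr1 px vE; rewrite aE bE !px_mix /c => e; lra.
have e2 : c * py v = k * (1 - x) * py y + (1 - k) * (1 - x') * py y'.
  have := congr1 py vE; rewrite aE bE !py_mix /c => e; lra.
by apply: planeP; apply: (mulfI cn0); rewrite !(px_mix, py_mix) mE ?e1 ?e2; field.
Qed.

(** A generating sequence of minimal length has no redundant point, so all its
    points are extreme. *)
Lemma polytope_minimal (G : set (plane R)) : polytope G ->
  exists s : seq (plane R), [/\ G = hull [set` s], uniq s &
    forall v, v \in s -> vertices G v].
Proof.
move=> [s0 s0E].
pose P n := `[< exists2 s : seq (plane R), G = hull [set` s] & size s = n >].
have exP : exists n, P n by exists (size s0); apply/asboolP; exists s0.
case: (ex_minnP exP) => n /asboolP[s sE sn] nmin.
have smin s' : G = hull [set` s'] -> (size s <= size s')%N.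
  by move=> s'E; rewrite sn; apply: nmin; apply/asboolP; exists s'.
exists s; split => // [|v vs].
  rewrite -[uniq s]negbK -ltn_size_undup -leqNgt; apply: smin.
  rewrite sE; congr hull; apply/seteqP.
  by split => q /=; rewrite mem_undup.
rewrite sE; apply: minimal_extreme => // rv.
have := smin (rem v s); rewrite hull_rem// => /(_ sE).
by rewrite size_rem//; case: (s) vs => //= a s' _; rewrite ltnn.
Qed.

(** A polytope with at most [m] extreme points is the hull of exactly [m] points,
    repeating one of them if need be.  The empty set is the only exception. *)
Lemma polytope_tuple (eta : R) m (G : set (plane R)) : (0 < m)%N ->
  polytopes eta m G -> G = set0 \/
    exists2 w : m.-tuple (plane R), G = hull [set` w] &
      forall i, (`[eta, 1 - eta] `*` `[eta, 1 - eta])%classic (tnth w i).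
Proof.
move=> m0 [/polytope_minimal[s [GE us sv]] Gsq Gm].
have sm : (size s <= m)%N.
  have : ([set` s] #<= `I_m)%card.
    by apply: card_le_trans Gm; apply: subset_card_le => v; exact: sv.
  have -> : [set` s] = [set` [fset x | x in s]%fset].
    by apply/seteqP; split => x /=; rewrite inE.
  by move/geq_card_fset_set; rewrite set_fsetK card_fseq undup_id.
case: s => [|a s] in GE us sv sm *.
  left; rewrite GE (_ : [set` [::]] = set0) ?hull0//.
  by apply/seteqP; split.
right; pose w := (a :: s) ++ nseq (m - size (a :: s)) a.
have sw : size w == m by rewrite size_cat size_nseq subnKC.
have wE : [set` w] = [set` a :: s].
  apply/seteqP; split => q /=; rewrite mem_cat; last by move->.
  by move=> /orP[//|]; rewrite mem_nseq inE => /andP[_ ->].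
exists (Tuple sw) => [|i]; first by rewrite GE wE.
apply: Gsq; rewrite GE -wE; apply: hull_sub => /=.
exact: (mem_tnth i (Tuple sw)).
Qed.

End ExtremePoints.

(** * Integrals of arbitrary functions; uniform laws and strips *)
Section LowerIntegral.
Local Open Scope ereal_scope.
Context d (T : measurableType d) (R : realType) (mu : {measure set T -> \bar R}).
Import HBNNSimple.

(** The integral of a nonnegative function is a supremum over the simple
    functions below it, so it is monotone for arbitrary functions.  It is what
    allows the likelihood, as a function of the vertices, to be bounded by
    functions constant on cells without any regularity of the hull map. *)
Lemma ge0_le_lower_integral (f g : T -> \bar R) :
  (forall x, 0 <= f x) -> (forall x, f x <= g x) ->
  \int[mu]_x f x <= \int[mu]_x g x.
Proof.
move=> f0 fg; have g0 x : 0 <= g x by exact: le_trans (fg x).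
rewrite !ge0_integralTE//; apply: le_ereal_sup => _ [h /= hf <-].
by exists h => // x; exact: le_trans (fg x).
Qed.

(** An infinite value on a null set is harmless, which turns bounds valid off a
    null set into bounds valid everywhere. *)
Lemma null_modification (N : set T) (g : T -> \bar R) :
  measurable N -> mu N = 0 -> measurable_fun setT g -> (forall x, 0 <= g x) ->
  \int[mu]_x (if x \in N then +oo else g x) = \int[mu]_x g x.
Proof.
move=> mN N0 mg g0; apply: ge0_ae_eq_integral => //.
- apply: measurable_fun_ifT => //; apply: measurable_fun_bool true _ => /=.
  by rewrite setTI (_ : _ @^-1` _ = N)//; apply/seteqP; split => x /= => [/set_mem|/mem_set].
- by move=> x _; case: ifP.
exists N; split => // x /= h; apply: contrapT => xN; apply: h => _.
by rewrite memNset.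
Qed.

Lemma integral_le_off_null (D N : set T) (f g : T -> \bar R) :
  measurable N -> mu N = 0 -> measurable_fun setT g -> (forall x, 0 <= g x) ->
  (forall x, ~ N x -> D x -> f x <= g x) ->
  \int[mu]_(x in D) f x <= \int[mu]_x g x.
Proof.
move=> mN N0 mg g0 fg.
rewrite integral_mkcond integralE -(null_modification mN N0 mg g0).
apply: (@le_trans _ _ (\int[mu]_x (f \_ D)^\+ x)).
  by rewrite -[leRHS]sube0 leeB// integral_ge0.
apply: ge0_le_lower_integral => // x; case: ifPn => [_|]; first exact: leey.
rewrite notin_setE => xN; rewrite funeposE patchE ge_max g0 andbT.
by case: ifPn => // /set_mem; exact: fg.
Qed.

Lemma integral_funeneg_off_null (N : set T) (f : T -> \bar R) :
  measurable N -> mu N = 0 -> (forall x, ~ N x -> 0 <= f x) ->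
  \int[mu]_x f^\- x = 0.
Proof.
move=> mN N0 f0; apply/eqP; rewrite eq_le integral_ge0// andbT.
rewrite -[leRHS](integral0 mu setT) -[leRHS](@null_modification N (cst 0) mN N0)//.
apply: ge0_le_lower_integral => // x; case: ifPn => [_|]; first exact: leey.
rewrite notin_setE => xN; rewrite funenegE ge_max lexx andbT leeNl oppe0.
exact: f0.
Qed.

Lemma integral_subset_off_null (D N : set T) (f : T -> \bar R) :
  measurable N -> mu N = 0 -> (forall x, ~ N x -> 0 <= f x) ->
  \int[mu]_(x in D) f x <= \int[mu]_x f x.
Proof.
move=> mN N0 f0; rewrite [leRHS]integralE (integral_funeneg_off_null mN)// sube0.
rewrite integral_mkcond integralE.
apply: (@le_trans _ _ (\int[mu]_x (f \_ D)^\+ x)).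
  by rewrite -[leRHS]sube0 leeB// integral_ge0.
apply: ge0_le_lower_integral => // x; rewrite !funeposE patchE.
by case: ifP => // _; rewrite maxxx le_max lexx orbT.
Qed.

Lemma integral_ge_off_null (N : set T) (f g : T -> \bar R) :
  measurable N -> mu N = 0 -> measurable_fun setT g -> (forall x, 0 <= g x) ->
  (forall x, ~ N x -> g x <= f x) ->
  \int[mu]_x g x <= \int[mu]_x f x.
Proof.
move=> mN N0 mg g0 gf; rewrite [leRHS]integralE (integral_funeneg_off_null mN)//.
  rewrite sube0.
  have -> : \int[mu]_x g x = \int[mu]_x (if x \in N then 0 else g x).
    apply: ge0_ae_eq_integral => //.
    - apply: measurable_fun_ifT => //; apply: measurable_fun_bool true _ => /=.
      by rewrite setTI (_ : _ @^-1` _ = N)//; apply/seteqP; split => x /= => [/set_mem|/mem_set].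
    - by move=> x _; case: ifP.
    exists N; split => // x /= h; apply: contrapT => xN; apply: h => _.
    by rewrite memNset.
  apply: ge0_le_lower_integral => x; first by case: ifP.
  case: ifPn => [_ //|]; rewrite notin_setE => xN.
  by rewrite funeposE le_max gf.
by move=> x /gf; apply: le_trans.
Qed.

Lemma measurable_scaled_indic (c : R) (A : set T) : measurable A ->
  measurable_fun setT (fun x => (c * \1_A x)%:E).
Proof. by move=> mA; apply/measurable_EFinP; exact: measurable_funM. Qed.

Lemma integral_scaled_indic (c : R) (A : set T) : (0 <= c)%R -> measurable A ->
  \int[mu]_x (c * \1_A x)%:E = c%:E * mu A.
Proof.
move=> c0 mA; under eq_integral => x _ do rewrite EFinM.
rewrite ge0_integralZl//; last exact/measurable_EFinP.
by rewrite integral_indic// setIT.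
Qed.

End LowerIntegral.

Section Uniform.
Context {R : realType}.
Local Open Scope ereal_scope.

Lemma uniform_probE (a b : R) (ab : (a < b)%R) (U : set (measurableTypeR R)) :
  measurable U ->
  uniform_prob ab U = (b - a)^-1%:E * lebesgue_measure (U `&` `[a, b]).
Proof.
move=> mU; rewrite /uniform_prob integral_uniform_pdf.
rewrite (eq_integral (cst (b - a)^-1%:E)); last first.
  move=> x /set_mem[_ /=]; rewrite in_itv/= => xab.
  by rewrite /uniform_pdf xab.
by rewrite integral_cst//; exact: measurableI.
Qed.

Lemma uniform_prob_itv (a b p q : R) (ab : (a < b)%R) :
  (a <= p)%R -> (p < q)%R -> (q <= b)%R ->
  uniform_prob ab `[p, q] = ((q - p) / (b - a))%:E.
Proof.
move=> ap pq qb; rewrite uniform_probE// setIidl; last first.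
  by move=> x /=; rewrite !in_itv/= => /andP[? ?]; apply/andP; split; lra.
by rewrite lebesgue_measure_itv/= lte_fin pq -EFinD -EFinM mulrC.
Qed.

Lemma uniform01_le (U : set (measurableTypeR R)) : measurable U ->
  uniform_prob (@ltr01 R) U <= lebesgue_measure U.
Proof.
move=> mU; rewrite uniform_probE// subr0 invr1 mul1e.
by apply: le_measure; rewrite ?inE//; exact: measurableI.
Qed.

Lemma uniform01_band (c e : R) : (0 <= e)%R ->
  uniform_prob (@ltr01 R) `[(c - e)%R, (c + e)%R] <= (2 * e)%:E.
Proof.
move=> e0; apply: le_trans (uniform01_le _) _ => //.
rewrite lebesgue_measure_itv/= lte_fin; case: ifPn => _; last by rewrite lee_fin mulr_ge0.
by rewrite -EFinD lee_fin; lra.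
Qed.

Lemma uniform_square_xsection (a b : R) (ab : (a < b)%R) (A : set (plane R)) e :
  measurable A -> (forall x, uniform_prob ab (xsection A x) <= e%:E) ->
  uniform_square ab A <= e%:E.
Proof.
move=> mA Ae; rewrite /uniform_square /= /product_measure1.
apply: (@le_trans _ _ (\int[uniform_prob ab]_x e%:E)).
  apply: ge0_le_lower_integral => // x; exact: measure_ge0.
by rewrite integral_cst// [X in _ * X](_ : _ = 1) ?mule1//; exact: (@probability_setT _ _ _ (uniform_prob ab)).
Qed.

Lemma uniform_square_ysection (a b : R) (ab : (a < b)%R) (A : set (plane R)) e :
  measurable A -> (forall y, uniform_prob ab (ysection A y) <= e%:E) ->
  uniform_square ab A <= e%:E.
Proof.
move=> mA Ae.
have -> : uniform_square ab A = \int[uniform_prob ab]_y uniform_prob ab (ysection A y).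
  have := indic_fubini_tonelli (uniform_prob ab) (uniform_prob ab) mA.
  rewrite (indic_fubini_tonelli_FE _ mA) (indic_fubini_tonelli_GE _ mA) => H.
  exact: H.
apply: (@le_trans _ _ (\int[uniform_prob ab]_x e%:E)).
  apply: ge0_le_lower_integral => // x; exact: measure_ge0.
by rewrite integral_cst// [X in _ * X](_ : _ = 1) ?mule1//; exact: (@probability_setT _ _ _ (uniform_prob ab)).
Qed.

Local Notation P01 := (uniform_square (@ltr01 R)).

(** By Fubini's theorem, in the direction of the coordinate of [v] equal to one. *)
Lemma uniform_strip (v a : plane R) (e : R) : (0 <= e)%R -> sup_unit v ->
  P01 (strip v a e) <= (2 * e)%:E.
Proof.
move=> e0 [[_ v1]|[v1 _]].
  apply: uniform_square_xsection => [|x]; first exact: measurable_strip.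
  rewrite (_ : xsection _ _ = `[(dot v a - px v * x - e)%R, (dot v a - px v * x + e)%R]%classic).
    exact: uniform01_band.
  apply/seteqP; split => y; rewrite /xsection /= in_itv/=.
    move=> /set_mem; rewrite /strip /= /dot v1 ler_norml /px /py /=.
    by move=> /andP[? ?]; apply/andP; split; lra.
  move=> H; apply/mem_set; move: H; rewrite /strip /= /dot v1 ler_norml /px /py /=.
  by move=> /andP[? ?]; apply/andP; split; lra.
apply: uniform_square_ysection => [|y]; first exact: measurable_strip.
rewrite (_ : ysection _ _ = `[(dot v a - py v * y - e)%R, (dot v a - py v * y + e)%R]%classic).
  exact: uniform01_band.
apply/seteqP; split => x; rewrite /ysection /= in_itv/=.
  move=> /set_mem; rewrite /strip /= /dot v1 ler_norml /px /py /=.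
  by move=> /andP[? ?]; apply/andP; split; lra.
move=> H; apply/mem_set; move: H; rewrite /strip /= /dot v1 ler_norml /px /py /=.
by move=> /andP[? ?]; apply/andP; split; lra.
Qed.

Lemma uniform_edge_strips k (w : k.-tuple (plane R)) (h : R) : (0 <= h)%R ->
  P01 (edge_strips w h) <= ((k ^ 2)%:R * (8 * h))%:E.
Proof.
move=> h0; rewrite /edge_strips.
have H (s : seq ('I_k * 'I_k)) : P01 (\big[setU/set0]_(z <- s)
    strip (normal (tnth w z.1) (tnth w z.2)) (tnth w z.1) (4 * h)) <=
    ((size s)%:R * (8 * h))%:E.
  elim: s => [|z s IH]; first by rewrite big_nil measure0 mul0r.
  rewrite big_cons; apply: le_trans (measureU2 _ _ _) _ => //.
  - exact: measurable_strip.
  - by apply: bigsetU_measurable => *; exact: measurable_strip.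
  have -> : ((size (z :: s))%:R * (8 * h))%:E =
      (2 * (4 * h))%:E + ((size s)%:R * (8 * h))%:E :> \bar R.
    by rewrite -EFinD /= -natr1; congr EFin; ring.
  by apply: leeD => //; apply: uniform_strip (normal_unit _ _); rewrite mulr_ge0.
apply: le_trans (H _) _; rewrite lee_fin ler_wpM2r ?mulr_ge0//.
by rewrite ler_nat -mulnn -[in leqRHS](card_ord k) -card_prod cardE enumT.
Qed.

End Uniform.

(** * Products over independent draws; the grid of cells *)
Section IidProduct.
Local Open Scope ereal_scope.
Context d (T : measurableType d) (R : realType) (P : probability T R).

Lemma measurable_prod_tnth n (G : 'I_n -> T -> R) :
  (forall i, measurable_fun setT (G i)) ->
  measurable_fun setT (fun x : n.-tuple T => (\prod_(i < n) G i (tnth x i))%R).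
Proof.
move=> mG; apply: measurable_prod => i _.
by apply: measurableT_comp => //; exact: measurable_tnth.
Qed.

(** Tonelli's theorem, peeling off one draw at a time. *)
Lemma integral_iid_prod n (G : 'I_n -> T -> R) :
  (forall i, measurable_fun setT (G i)) -> (forall i x, (0 <= G i x)%R) ->
  \int[iid P n]_x (\prod_(i < n) G i (tnth x i))%R%:E =
  \prod_(i < n) \int[P]_x (G i x)%:E.
Proof.
elim: n G => [|n IH] G mG G0.
  rewrite big_ord0 /= integral_dirac//; last first.
    by apply/measurable_EFinP; apply: measurable_prod_tnth.
  by rewrite big_ord0 diracT mul1e.
rewrite /= ge0_integral_pushforward//=; last 2 first.
- by apply/measurable_EFinP; exact: measurable_prod_tnth.
- by move=> x _; rewrite lee_fin prodr_ge0.
rewrite preimage_setT big_ord_recl -(IH (fun i => G (lift ord0 i)))//.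
have mtail : measurable_fun setT (fun y : n.-tuple T =>
    (\prod_(i < n) G (lift ord0 i) (tnth y i))%R).
  exact: (@measurable_prod_tnth n (fun i => G (lift ord0 i))).
under eq_integral => z _ do rewrite big_ord_recl /=.
have tE (z : T * n.-tuple T) i : tnth (tuple_cons z) (lift ord0 i) = tnth z.2 i.
  by rewrite /tuple_cons tnthS.
under eq_integral => z _.
  under eq_bigr do rewrite tE.
  over.
rewrite fubini_tonelli1//=; last 2 first.
- apply/measurable_EFinP; apply: measurable_funM.
    by apply: measurableT_comp => //; exact: measurable_fst.
  by apply: (measurableT_comp mtail); exact: measurable_snd.
- by move=> z; rewrite lee_fin mulr_ge0// prodr_ge0.
rewrite /fubini_F /=.
set I := \int[iid P n]_x _.
have key x : \int[iid P n]_y (G ord0 x *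
    \prod_(i < n) G (lift ord0 i) (tnth y i))%R%:E = (G ord0 x)%:E * I.
  rewrite -ge0_integralZl//; last by rewrite lee_fin.
  - exact/measurable_EFinP.
  - by move=> y _; rewrite lee_fin prodr_ge0.
under eq_integral => x _ do rewrite key.
rewrite ge0_integralZr//.
- exact/measurable_EFinP.
- by move=> x _; rewrite lee_fin.
- by apply: integral_ge0 => y _; rewrite lee_fin prodr_ge0.
Qed.

Lemma measurable_iid_box n (A : 'I_n -> set T) : (forall i, measurable (A i)) ->
  measurable [set x : n.-tuple T | forall i, A i (tnth x i)].
Proof.
move=> mA; rewrite (_ : mkset _ =
    \big[setI/setT]_(i < n) ((fun x : n.-tuple T => tnth x i) @^-1` A i)).
  apply: bigsetI_measurable => i _; rewrite -[X in measurable X]setTI.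
  exact: measurable_tnth.
rewrite -bigcap_seq; apply/seteqP; split => x H i; last by apply: H; rewrite /= mem_index_enum.
by move=> _; exact: H.
Qed.

Lemma iid_box n (A : 'I_n -> set T) : (forall i, measurable (A i)) ->
  iid P n [set x : n.-tuple T | forall i, A i (tnth x i)] = \prod_(i < n) P (A i).
Proof.
move=> mA; set B := mkset _; have mB : measurable B := measurable_iid_box mA.
have -> : iid P n B = \int[iid P n]_x (\1_B x)%:E by rewrite integral_indic// setIT.
transitivity (\int[iid P n]_x (\prod_(i < n) \1_(A i) (tnth x i))%R%:E).
  apply: eq_integral => x _; congr EFin; rewrite indicE.
  have [/set_mem xB|/negP xB] := boolP (x \in B).
    by rewrite big1// => i _; rewrite indicE mem_set//; exact: xB.
  apply/esym/eqP; rewrite prodf_seq_eq0; apply/hasP.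
  have [i Ai] : exists i, ~ A i (tnth x i).
    by apply/existsNP => H; apply: xB; apply/mem_set.
  by exists i; rewrite ?mem_index_enum//= indicE memNset.
rewrite (@integral_iid_prod n (fun i => \1_(A i)))//; apply: eq_bigr => i _.
by rewrite integral_indic// setIT.
Qed.

End IidProduct.

Section Grid.
Context {R : realType}.
Variables (eta : R) (heta : 0 < eta < 1 / 2) (M : nat) (M0 : (0 < M)%N).
Local Notation Q := (uniform_square (eta_lt heta)).

Definition mesh : R := (1 - 2 * eta) / M%:R.

Definition cell1 (a : nat) : set (measurableTypeR R) :=
  `[(eta + a%:R * mesh)%R, (eta + a.+1%:R * mesh)%R].

Definition cell2 (a : 'I_M * 'I_M) : set (plane R) := cell1 a.1 `*` cell1 a.2.

(** The cell of index [j]: [j.1] is the grid square of the pair of rates and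
    [j.2] gives the grid squares of the vertices. *)
Definition cell k (j : ('I_M * 'I_M) * k.-tuple ('I_M * 'I_M)) :
    set ((measurableTypeR R * measurableTypeR R) * k.-tuple (plane R)) :=
  cell2 j.1 `*` [set w | forall i, cell2 (tnth j.2 i) (tnth w i)].

Lemma mesh_gt0 : 0 < mesh.
Proof.
by case/andP: heta => ? ?; rewrite divr_gt0 ?ltr0n//; lra.
Qed.

Lemma mesh_le : mesh <= M%:R^-1.
Proof.
case/andP: heta => ? ?; rewrite /mesh -[leRHS]mul1r ler_wpM2r ?invr_ge0//; lra.
Qed.

Lemma M_mesh : M%:R * mesh = 1 - 2 * eta.
Proof. by rewrite /mesh mulrC divfK// pnatr_eq0 -lt0n. Qed.

Lemma uniform_cell1 a : (a < M)%N ->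
  uniform_prob (eta_lt heta) (cell1 a) = (M%:R^-1)%:E.
Proof.
move=> aM; have h0 := mesh_gt0; have Mh := M_mesh.
case/andP: (heta) => e0 e1.
have aM' : a.+1%:R * mesh <= M%:R * mesh by rewrite ler_pM2r// ler_nat.
rewrite uniform_prob_itv.
- congr EFin; rewrite -natr1 /mesh.
  have ? : M%:R != 0 :> R by rewrite pnatr_eq0 -lt0n.
  by field; apply/andP; split=> //; rewrite gt_eqF//; lra.
- by rewrite lerDl mulr_ge0// ltW.
- by rewrite ltrD2l ltr_pM2r// ltr_nat.
- lra.
Qed.

Lemma measurable_cell1 a : measurable (cell1 a).
Proof. exact: measurable_itv. Qed.

Lemma measurable_cell2 a : measurable (cell2 a).
Proof. by apply: measurableX; exact: measurable_cell1. Qed.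

Lemma measurable_cell k (j : ('I_M * 'I_M) * k.-tuple ('I_M * 'I_M)) :
  measurable (cell j).
Proof.
apply: measurableX; first exact: measurable_cell2.
by apply: (@measurable_iid_box _ _ k (fun i => cell2 (tnth j.2 i))) => i;
  exact: measurable_cell2.
Qed.

Lemma uniform_cell2 a : Q (cell2 a) = (M%:R^-1 ^+ 2)%:E.
Proof.
rewrite /uniform_square /= product_measure1E; try exact: measurable_cell1.
transitivity ((M%:R^-1 : R)%:E * (M%:R^-1)%:E)%E; last by rewrite -EFinM.
by congr (_ * _)%E; exact: uniform_cell1.
Qed.

(** All cells of [k] vertices have the same prior mass, the grid being uniform in
    its [2 * k.+1] coordinates. *)
Lemma draw_law_cell k (j : ('I_M * 'I_M) * k.-tuple ('I_M * 'I_M)) :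
  draw_law heta k (cell j) = (M%:R^-1 ^+ (2 * k.+1))%:E.
Proof.
rewrite /draw_law /= product_measure1E; last 2 first.
- exact: measurable_cell2.
- by apply: (@measurable_iid_box _ _ k (fun i => cell2 (tnth j.2 i))) => i;
    exact: measurable_cell2.
transitivity ((M%:R^-1 ^+ 2)%:E * \prod_(i < k) (M%:R^-1 ^+ 2)%:E : \bar R)%E.
  congr (_ * _)%E; first exact: uniform_cell2.
  apply: (etrans (@iid_box _ _ R Q k (fun i => cell2 (tnth j.2 i)) _)).
    by move=> i; exact: measurable_cell2.
  by apply: eq_bigr => i _; exact: uniform_cell2.
rewrite prodEFin -EFinM prodr_const card_ord -exprM -exprD.
by rewrite mulnS.
Qed.

Lemma cell1_cover (x : R) : x \in `[eta, 1 - eta] ->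
  exists a : 'I_M, cell1 a x.
Proof.
rewrite in_itv/= => /andP[x0 x1].
have h0 := mesh_gt0; have Mh := M_mesh.
pose P a := `[< x <= eta + a.+1%:R * mesh >].
have PM : P M.-1 by apply/asboolP; rewrite prednK// Mh; lra.
have exP : exists a, P a by exists M.-1.
case: (ex_minnP exP) => a /asboolP Pa amin.
have aM : (a < M)%N by apply: leq_ltn_trans (amin _ PM) _; rewrite prednK.
exists (Ordinal aM); rewrite /cell1 /= in_itv/= Pa andbT.
case: a amin Pa {aM} => [|a] amin Pa; first by rewrite mul0r addr0.
rewrite leNgt; apply/negP => xa.
have : P a by apply/asboolP; exact: ltW.
by move/amin; rewrite ltnn.
Qed.

Lemma cell1_dist a (x y : R) : cell1 a x -> cell1 a y -> `|x - y| <= mesh.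
Proof.
rewrite /cell1 /= !in_itv/= -natr1 => /andP[? ?] /andP[? ?].
by rewrite ler_norml; lra.
Qed.

End Grid.

(** * Likelihood ratios and discriminating regions *)
HB.lock Definition pr (R : realType) (A : set (plane R)) : R :=
  fine (uniform_square (@ltr01 R) A).

Section PlaneProb.
Context {R : realType}.
Local Notation P01 := (uniform_square (@ltr01 R)).
Implicit Types A B : set (plane R).


Lemma prE A : measurable A -> P01 A = (pr A)%:E.
Proof. by move=> mA; rewrite pr.unlock fineK// fin_num_measure. Qed.

Lemma pr_ge0 A : 0 <= pr A.
Proof. by rewrite pr.unlock fine_ge0// measure_ge0. Qed.

Lemma pr_le1 A : measurable A -> pr A <= 1.
Proof. by move=> mA; rewrite -lee_fin -prE// probability_le1. Qed.

Lemma le_pr A B : measurable A -> measurable B -> A `<=` B -> pr A <= pr B.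
Proof. move=> mA mB AB; rewrite -lee_fin -(prE mA) -(prE mB).
by apply: le_measure => //; exact/mem_set. Qed.

Lemma prU A B : measurable A -> measurable B -> pr (A `|` B) <= pr A + pr B.
Proof.
move=> mA mB; rewrite -lee_fin EFinD -(prE mA) -(prE mB).
rewrite -(prE (measurableU _ _ mA mB)); exact: measureU2.
Qed.

Lemma measurableY A B : measurable A -> measurable B -> measurable (A `+` B).
Proof. by move=> mA mB; rewrite setY_def; apply: measurableU; exact: measurableD. Qed.

Definition unit_square : set (plane R) := `[0, 1] `*` `[0, 1].

(** Inside the unit square the uniform probability is the area. *)
Lemma area_le_pr A : measurable A -> A `<=` unit_square ->
  (area A <= (pr A)%:E)%E.
Proof.
move=> mA A01; rewrite -prE// /area /uniform_square /= /product_measure1 /=.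
have mphi : measurable_fun setT (fun x => uniform_prob (@ltr01 R) (xsection A x)).
  exact: (measurable_fun_xsection (uniform_prob (@ltr01 R)) mA).
rewrite integral_uniform//= subr0 invr1 mul1e.
rewrite [leRHS]integral_mkcond/=; apply: ge0_le_lower_integral => [x|x].
  exact: measure_ge0.
rewrite patchE; case: ifPn => [_|].
  rewrite /comp uniform_probE; last exact: measurable_xsection.
  rewrite subr0 invr1 mul1e setIidl// => y; rewrite /xsection /= => /set_mem /A01.
  by case.
rewrite /comp => x01; rewrite (_ : xsection A x = set0) ?measure0//.
rewrite -subset0 => y; rewrite /xsection /= => /set_mem /A01[/= h _].
by move/negP : x01; apply; exact/mem_set.
Qed.

(** The hull of at most two points lies in a strip of width zero. *)
Lemma hull_null (s : seq (plane R)) : (size s <= 2)%N -> pr (hull [set` s]) = 0.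
Proof.
have H (a b : plane R) (s' : seq (plane R)) : (forall q, q \in s' -> q = a \/ q = b) ->
    pr (hull [set` s']) = 0.
  move=> sab; apply/eqP; rewrite eq_le pr_ge0 andbT.
  have v1 := normal_unit a b.
  have mS : measurable (strip (normal a b) a 0) by exact: measurable_strip.
  apply: (@le_trans _ _ (pr (strip (normal a b) a 0))); last first.
    have := uniform_strip a (lexx 0) v1; rewrite prE// lee_fin mulr0; exact.
  apply: le_pr => //; first exact: measurable_hull.
  apply: hull_min.
    apply/convex_planeP => p q t t0 t1; rewrite /strip /= !normr_le0 !subr_eq0.
    by move=> /eqP e1 /eqP e2; rewrite dot_mix e1 e2; apply/eqP; ring.
  move=> q /sab[->|->]; rewrite /strip /= ?subrr ?normr0//.
  by rewrite dot_normal subrr normr0.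
case: s => [|a [|b [|]]]// _.
- by apply: (@H (0,0) (0,0)) => q.
- by apply: (H a a) => q; rewrite inE => /eqP; left.
- by apply: (H a b) => q; rewrite !inE => /orP[]/eqP; [left|right].
Qed.

Definition left_band (e : R) : set (plane R) := `]-oo, e[ `*` setT.

Lemma measurable_left_band e : measurable (left_band e).
Proof. by apply: measurableX => //; exact: measurable_itv. Qed.

Lemma pr_left_band (e : R) : 0 < e -> e <= 1 -> pr (left_band e) = e.
Proof.
move=> e0 e1; rewrite pr.unlock /left_band /uniform_square /= product_measure1E//.
rewrite [X in (_ * X)%E](_ : _ = 1%E); last exact: (@probability_setT _ _ _ (uniform_prob ltr01)).
rewrite mule1.
transitivity (fine (uniform_prob (@ltr01 R) `]-oo, e[)) => //.
rewrite uniform_probE// subr0 invr1 mul1e.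
rewrite (_ : _ `&` _ = `[0, e[%classic).
  by rewrite lebesgue_measure_itv/= lte_fin e0 -EFinD subr0.
apply/seteqP; split => x /=; rewrite !in_itv/=.
  by move=> [-> /andP[-> _]].
by move=> /andP[-> h]; rewrite h; split => //; apply: le_trans e1; exact: ltW.
Qed.

End PlaneProb.

Section Affinity.
Context {R : realType}.
Implicit Types p q : R.

(** One minus the affinity is half the squared Hellinger distance, and
    [p - q = (sqrt p - sqrt q) * (sqrt p + sqrt q)] with a sum at most two. *)
Lemma hellinger_le p q : 0 <= p <= 1 -> 0 <= q <= 1 ->
  Num.sqrt (p * q) + Num.sqrt ((1 - p) * (1 - q)) <= 1 - (p - q) ^+ 2 / 8.
Proof.
move=> /andP[p0 p1] /andP[q0 q1].
rewrite !sqrtrM ?subr_ge0//.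
have := sqr_sqrtr p0; have := sqr_sqrtr q0.
have := sqrtr_ge0 p; have := sqrtr_ge0 q.
have : 0 <= 1 - p by lra.
have : 0 <= 1 - q by lra.
move=> q1' p1'; have := sqr_sqrtr p1'; have := sqr_sqrtr q1'.
have : Num.sqrt p <= 1 by rewrite -sqrtr1 ler_wsqrtr.
have : Num.sqrt q <= 1 by rewrite -sqrtr1 ler_wsqrtr.
move: (Num.sqrt p) (Num.sqrt q) (Num.sqrt (1 - p)) (Num.sqrt (1 - q)) => a b c d.
move=> b1 a1 d2 c2 b0 a0 b2 a2.
have ab2 : (p - q) ^+ 2 <= 4 * (a - b) ^+ 2.
  have -> : p - q = (a - b) * (a + b) by rewrite -a2 -b2; ring.
  rewrite exprMn mulrC ler_wpM2r ?sqr_ge0//.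
  have -> : 4 = 2 ^+ 2 :> R by ring.
  by rewrite lerXn2r ?nnegrE//; lra.
have : 0 <= (c - d) ^+ 2 by exact: sqr_ge0.
by nra.
Qed.

End Affinity.

Section Likelihood.
Context {R : realType}.
Variables (eta : R) (heta : 0 < eta < 1 / 2).
Implicit Types (th : param R) (x : plane R) (S : set (plane R)).

Definition obs_pmf th x (b : bool) : R := bernoulli_pmf (success th x) b.

Definition rates_in th := th.1.1 \in `[eta, 1 - eta] /\ th.1.2 \in `[eta, 1 - eta].

Lemma success_in th x : rates_in th -> eta <= success th x <= 1 - eta.
Proof. by rewrite /rates_in !in_itv /success => -[? ?]; case: ifP. Qed.

Lemma obs_pmf_in th x b : rates_in th -> eta <= obs_pmf th x b <= 1 - eta.
Proof.
move=> /success_in => /(_ x) /andP[? ?]; rewrite /obs_pmf /bernoulli_pmf.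
by case: b; apply/andP; split; lra.
Qed.

Lemma obs_pmf_gt0 th x b : rates_in th -> 0 < obs_pmf th x b.
Proof. by case/andP: heta => e0 _ /obs_pmf_in => /(_ x b) /andP[+ _]; exact: lt_le_trans. Qed.

Lemma obs_pmf_le1 th x b : rates_in th -> obs_pmf th x b <= 1.
Proof. by case/andP: heta => e0 _ /obs_pmf_in => /(_ x b) /andP[_ ?]; lra. Qed.

(** Bound on the likelihood ratio of one observation at [x] between two
    parameters whose rates differ by at most [h] and whose sets agree off [S].
    Off [S] the ratio is at most [1 + h / eta]; on [S] it is at most [eta^-1],
    as all rates are in [[eta, 1 - eta]]. *)
Definition tilt (h : R) S x : R := (1 + h / eta) * (if x \in S then eta^-1 else 1).

Lemma eta_inv_ge1 : 1 <= eta^-1.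
Proof. by case/andP: heta => ? ?; rewrite invf_ge1//; lra. Qed.

Lemma tilt_ge1 h S x : 0 <= h -> 1 <= tilt h S x.
Proof.
move=> h0; have := eta_inv_ge1; case/andP: heta => e0 _ ei.
have : 0 <= h / eta by rewrite divr_ge0// ltW.
by rewrite /tilt; case: ifP => _; nra.
Qed.

Lemma obs_pmf_le_tilt th th' h S x b : 0 <= h -> rates_in th -> rates_in th' ->
  `|th.1.1 - th'.1.1| <= h -> `|th.1.2 - th'.1.2| <= h ->
  (~ S x -> (th.2 x <-> th'.2 x)) -> obs_pmf th x b <= obs_pmf th' x b * tilt h S x.
Proof.
move=> h0 r r' d1 d2 ag.
have /andP[e1 _] := obs_pmf_in x b r'; have l1 := obs_pmf_le1 x b r.
have ei := eta_inv_ge1; case/andP: (heta) => e0 _.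
have ehh : 0 <= h / eta by rewrite divr_ge0// ltW.
have eei : eta * eta^-1 = 1 by rewrite divff// gt_eqF.
have ehe : eta * (h / eta) = h by rewrite mulrC divfK// gt_eqF.
rewrite /tilt; case: ifPn => [_|/negP xS].
  move: (obs_pmf th' x b) (obs_pmf th x b) (eta^-1) (h / eta) ei e1 l1 ehh eei => q p i z.
  move=> i1 eq p1 z0 ei.
  apply: (le_trans p1); rewrite mulrA -ei ler_wpM2r//; first lra.
  nra.
have eqm : (x \in th.2) = (x \in th'.2).
  have [g1 g2] := ag (fun xs => xS (mem_set xs)).
  by apply/idP/idP => /set_mem ?; apply/mem_set; auto.
have : `|success th x - success th' x| <= h.
  by rewrite /success eqm; case: ifP.
rewrite mulr1 ler_norml => /andP[? ?].
have : obs_pmf th x b <= obs_pmf th' x b + h.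
  by rewrite /obs_pmf /bernoulli_pmf; case: b {e1 l1}; lra.
move: (obs_pmf th' x b) (obs_pmf th x b) (h / eta) ehh ehe e1 => q p z; nra.
Qed.

Lemma likelihoodE th n (x : n.-tuple (plane R)) (y : n.-tuple bool) :
  likelihood th x y = \prod_(i < n) obs_pmf th (tnth x i) (tnth y i).
Proof. by []. Qed.

Lemma likelihood_gt0 th n (x : n.-tuple (plane R)) (y : n.-tuple bool) :
  rates_in th -> 0 < likelihood th x y.
Proof. by move=> r; rewrite likelihoodE prodr_gt0// => i _; exact: obs_pmf_gt0. Qed.

Lemma likelihood_le1 th n (x : n.-tuple (plane R)) (y : n.-tuple bool) :
  rates_in th -> likelihood th x y <= 1.
Proof.
move=> r; rewrite likelihoodE; apply: prodr_ile1 => i _.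
by rewrite ltW ?obs_pmf_gt0 ?obs_pmf_le1.
Qed.

Lemma likelihood_le_tilt th th' h S n (x : n.-tuple (plane R)) (y : n.-tuple bool) :
  0 <= h -> rates_in th -> rates_in th' ->
  `|th.1.1 - th'.1.1| <= h -> `|th.1.2 - th'.1.2| <= h ->
  (forall x, ~ S x -> (th.2 x <-> th'.2 x)) ->
  likelihood th x y <= likelihood th' x y * \prod_(i < n) tilt h S (tnth x i).
Proof.
move=> h0 r r' d1 d2 ag; rewrite !likelihoodE -big_split/=.
apply: ler_prod => i _; apply/andP; split; first exact/ltW/obs_pmf_gt0.
by apply: obs_pmf_le_tilt => //; exact: ag.
Qed.

(** Where the success probabilities under [th] and [th0] differ by a fixed
    amount.  If [rho] is away from [rho0], the outer band of abscissae below [eta]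
    will do: it lies in neither set.  Otherwise [rho] is away from [xi0], and
    either [xi] is away from [rho0], so that the whole symmetric difference
    discriminates, or [xi] is close to [rho0], hence away from [xi0], and all of
    [th0.2] discriminates. *)
Lemma discriminate th0 th :
  rates_in th0 -> rates_in th -> measurable th0.2 -> measurable th.2 ->
  (forall x, th0.2 x -> eta <= px x) -> (forall x, th.2 x -> eta <= px x) ->
  exists B, [/\ measurable B,
    forall x, B x -> `|th0.1.1 - th0.1.2| / 4 <= `|success th0 x - success th x| &
    eta * Num.min (pr (th.2 `+` th0.2)) (pr th0.2) <= pr B].
Proof.
move=> r0 r m0 m l0 l; case/andP: (heta) => e0 e1.
set D := `|th0.1.1 - th0.1.2|.
have D0 : 0 <= D := normr_ge0 _.
have eta1 : eta <= 1 by lra.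
have mY : measurable (th.2 `+` th0.2) by exact: measurableY.
have min0 : 0 <= Num.min (pr (th.2 `+` th0.2)) (pr th0.2) by rewrite le_min !pr_ge0.
have minl : Num.min (pr (th.2 `+` th0.2)) (pr th0.2) <= pr (th.2 `+` th0.2).
  by rewrite ge_min lexx.
have minr : Num.min (pr (th.2 `+` th0.2)) (pr th0.2) <= pr th0.2.
  by rewrite ge_min lexx orbT.
have etamin A : Num.min (pr (th.2 `+` th0.2)) (pr th0.2) <= pr A ->
    eta * Num.min (pr (th.2 `+` th0.2)) (pr th0.2) <= pr A.
  by move=> h; apply: le_trans h; rewrite ler_piMl.
have [c1|c1] := leP (D / 4) `|th0.1.2 - th.1.2|.
  exists (left_band eta); split; first exact: measurable_left_band.
    move=> x [/= + _]; rewrite in_itv/= => xe.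
    rewrite /success !memNset//; first by move/l; rewrite leNgt /px xe.
    by move/l0; rewrite leNgt /px xe.
  rewrite pr_left_band// ler_piMr//; first exact: ltW.
  exact: le_trans minl (pr_le1 mY).
have [c2|c2] := leP (D / 4) `|th0.1.2 - th.1.1|.
  exists (th.2 `+` th0.2); split => //; last exact: etamin.
  move=> x; rewrite setY_def => -[[xt xt0]|[xt0 xt]]; rewrite /success.
    by rewrite (mem_set xt) memNset.
  rewrite (mem_set xt0) (memNset xt).
  have := ler_distD th.1.2 th0.1.1 th0.1.2; rewrite -/D (distrC th.1.2).
  by move: c1; lra.
exists th0.2; split => //; last exact: etamin.
move=> x xt0; rewrite /success (mem_set xt0); case: ifP => _.
  have := ler_distD th.1.1 th0.1.1 th0.1.2; rewrite -/D (distrC th.1.1).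
  by move: c2; lra.
have := ler_distD th.1.2 th0.1.1 th0.1.2; rewrite -/D (distrC th.1.2).
by move: c1; lra.
Qed.

End Likelihood.

(** * Hellinger affinities of perturbed likelihoods *)
Lemma sum_tuple_prod (R : comPzRingType) n (f : 'I_n -> bool -> R) :
  \sum_(y : n.-tuple bool) \prod_(i < n) f i (tnth y i) =
  \prod_(i < n) \sum_b f i b.
Proof.
rewrite bigA_distr_bigA/=.
rewrite (reindex (fun y : n.-tuple bool => [ffun i => tnth y i]))/=.
  by apply: eq_bigr => y _; apply: eq_bigr => i _; rewrite ffunE.
exists (fun f : {ffun 'I_n -> bool} => [tuple f i | i < n]) => [y _|g _].
  by apply: eq_from_tnth => i; rewrite tnth_mktuple ffunE.
by apply/ffunP => i; rewrite ffunE tnth_mktuple.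
Qed.

Lemma sqrtr_prod (R : rcfType) n (f : 'I_n -> R) : (forall i, 0 <= f i) ->
  Num.sqrt (\prod_(i < n) f i) = \prod_(i < n) Num.sqrt (f i).
Proof.
elim: n f => [|n IH] f f0; first by rewrite !big_ord0 sqrtr1.
by rewrite !big_ord_recr/= sqrtrM ?prodr_ge0// IH.
Qed.

Section Affinity.
Context {R : realType}.
Variables (eta : R) (heta : 0 < eta < 1 / 2).
Implicit Types (th : param R) (x : plane R) (S B : set (plane R)).

Variables (th0 th : param R) (r0 : rates_in eta th0) (r : rates_in eta th).
Variables (h : R) (h0 : 0 <= h) (S0 S B : set (plane R)).
Variables (D : R) (D0 : 0 <= D)
  (BD : forall x, B x -> D <= `|success th0 x - success th x|).

(** Likelihood ratio of one observation, enlarged by the variation of the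
    numerator over its cell and of the denominator over the cell of the truth. *)
Definition tilted_ratio x b : R :=
  obs_pmf th x b * tilt eta h S x * tilt eta h S0 x / obs_pmf th0 x b.

(** Bound on the affinity of one observation: [B] is the discriminating region,
    and a point of a strip costs at most [eta^-1]. *)
Definition majorant x : R := (1 + h / eta) *
  (1 - D ^+ 2 / 8 * \1_B x + eta^-1 * \1_S x + eta^-1 * \1_S0 x).

Lemma tilted_ratio_ge0 x b : 0 <= tilted_ratio x b.
Proof.
have t1 := tilt_ge1 heta S x h0; have t2 := tilt_ge1 heta S0 x h0.
apply: divr_ge0; last exact: ltW (obs_pmf_gt0 heta _ _ r0).
apply: mulr_ge0; last exact: le_trans ler01 t2.
by apply: mulr_ge0; [exact: ltW (obs_pmf_gt0 heta _ _ r)|exact: le_trans ler01 t1].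
Qed.

Lemma sqrt_ratio x b : obs_pmf th0 x b * Num.sqrt (tilted_ratio x b) =
  Num.sqrt (tilt eta h S x * tilt eta h S0 x) * Num.sqrt (obs_pmf th0 x b * obs_pmf th x b).
Proof.
have p0 := obs_pmf_gt0 heta x b r0; have p := obs_pmf_gt0 heta x b r.
have t1 := le_trans ler01 (tilt_ge1 heta S x h0).
have t2 := le_trans ler01 (tilt_ge1 heta S0 x h0).
transitivity (Num.sqrt (obs_pmf th0 x b ^+ 2) * Num.sqrt (tilted_ratio x b)).
  by rewrite sqrtr_sqr ger0_norm// ltW.
have t12 : 0 <= tilt eta h S x * tilt eta h S0 x by exact: mulr_ge0.
rewrite -(sqrtrM _ (sqr_ge0 _)) -(sqrtrM _ t12); congr (Num.sqrt _); rewrite /tilted_ratio.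
by field; rewrite gt_eqF.
Qed.

(** The Hellinger bound on the law of the response, times the square root of the
    two tilts: this root is [1 + h / eta] off both [S] and [S0], and at most
    [(1 + h / eta) / eta] on them. *)
Lemma affinity_le x : \sum_b obs_pmf th0 x b * Num.sqrt (tilted_ratio x b) <= majorant x.
Proof.
under eq_bigr do rewrite sqrt_ratio.
rewrite -mulr_sumr big_bool /obs_pmf /bernoulli_pmf /=.
set p := success th0 x; set q := success th x.
have /andP[? ?] := success_in x r0; have /andP[? ?] := success_in x r.
case/andP: (heta) => e0 e1.
have Hh : Num.sqrt (p * q) + Num.sqrt ((1 - p) * (1 - q)) <=
    1 - D ^+ 2 / 8 * \1_B x.
  apply: le_trans (hellinger_le _ _) _; rewrite -/p -/q.
  - by apply/andP; split; rewrite /p; lra.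
  - by apply/andP; split; rewrite /q; lra.
  rewrite indicE; have [/set_mem xB|_] := boolP (x \in B).
    rewrite mulr1 lerD2l lerN2 ler_wpM2r//.
    by rewrite -[leRHS]ger0_norm ?sqr_ge0// normrX lerXn2r ?nnegrE// BD.
  by rewrite mulr0 lerD2l lerN2 divr_ge0// sqr_ge0.
have H1 : 1 - D ^+ 2 / 8 * \1_B x <= 1.
  by rewrite gerBl mulr_ge0// divr_ge0// sqr_ge0.
have H0 : 0 <= Num.sqrt (p * q) + Num.sqrt ((1 - p) * (1 - q)).
  by rewrite addr_ge0// sqrtr_ge0.
set H := _ + _ in Hh H0 *; set G := 1 - _ in Hh H1.
have z0 : 0 <= h / eta by rewrite divr_ge0// ltW.
have i1 := eta_inv_ge1 heta.
have i0 : 0 <= eta^-1 by exact: le_trans i1.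
have z1 : 0 <= 1 + h / eta by rewrite addr_ge0.
rewrite /majorant -/G /tilt !indicE.
have -> : (1 + h / eta) * (if x \in S then eta^-1 else 1) *
    ((1 + h / eta) * (if x \in S0 then eta^-1 else 1)) =
    (1 + h / eta) ^+ 2 * ((if x \in S then eta^-1 else 1) *
      (if x \in S0 then eta^-1 else 1)) by ring.
rewrite sqrtrM ?sqr_ge0// sqrtr_sqr (ger0_norm z1) -mulrA ler_wpM2l//.
have s1 : Num.sqrt eta^-1 <= eta^-1.
  rewrite -[leRHS](ger0_norm i0) -sqrtr_sqr ler_wsqrtr// expr2; nra.
case: (x \in S); case: (x \in S0); rewrite ?mulr1 ?mul1r ?mulr0 ?addr0 ?sqrtr1 ?mul1r//.
- rewrite -expr2 sqrtr_sqr ger0_norm//.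
  have : 0 <= G by exact: le_trans Hh.
  by move: (eta^-1) i1 i0 => i i1 i0; nra.
- have sq0 := sqrtr_ge0 (eta^-1).
  by move: (Num.sqrt eta^-1) (eta^-1) s1 i1 i0 sq0 => s i s1 i1 i0 sq0; nra.
- have sq0 := sqrtr_ge0 (eta^-1).
  by move: (Num.sqrt eta^-1) (eta^-1) s1 i1 i0 sq0 => s i s1 i1 i0 sq0; nra.
Qed.

Lemma majorant_ge0 x : 0 <= majorant x.
Proof.
apply: le_trans (affinity_le x); apply: sumr_ge0 => b _.
by rewrite mulr_ge0 ?sqrtr_ge0// ltW// (obs_pmf_gt0 heta).
Qed.

(** Summing over the responses factorizes because, given the design, they are
    independent. *)
Lemma sum_sqrt_ratio n (X : n.-tuple (plane R)) :
  \sum_(y : n.-tuple bool) likelihood th0 X y *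
     Num.sqrt (\prod_(i < n) tilted_ratio (tnth X i) (tnth y i)) <=
  \prod_(i < n) majorant (tnth X i).
Proof.
under eq_bigr => y _.
  rewrite sqrtr_prod; last by move=> i; exact: tilted_ratio_ge0.
  rewrite likelihoodE -big_split/=; over.
rewrite (@sum_tuple_prod R n (fun i b => obs_pmf th0 (tnth X i) b *
  Num.sqrt (tilted_ratio (tnth X i) b))).
apply: ler_prod => i _; rewrite affinity_le andbT.
by apply: sumr_ge0 => b _; rewrite mulr_ge0 ?sqrtr_ge0// ltW// (obs_pmf_gt0 heta).
Qed.

Hypotheses (mS0 : measurable S0) (mS : measurable S) (mB : measurable B).

Lemma measurable_majorant : measurable_fun setT majorant.
Proof.
apply: measurable_funM => //; apply: measurable_funD; last exact: measurable_funM.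
apply: measurable_funD; last exact: measurable_funM.
by apply: measurable_funB => //; exact: measurable_funM.
Qed.

Lemma integral_majorant :
  (\int[uniform_square (@ltr01 R)]_x (majorant x)%:E <=
   (expR (h / eta + (pr S + pr S0) / eta - D ^+ 2 / 8 * pr B))%:E)%E.
Proof.
set P := uniform_square _.
have z0 : 0 <= h / eta by rewrite divr_ge0// ltW//; case/andP: heta.
have i0 : 0 <= eta^-1 := le_trans ler01 (eta_inv_ge1 heta).
have ind (c : R) A : 0 <= c -> measurable A ->
    (\int[P]_x (c * \1_A x)%:E = (c * pr A)%:E)%E.
  by move=> c0 mA; rewrite EFinM -prE//; exact: integral_scaled_indic.
have mc (c : R) A : measurable A -> measurable_fun setT (fun x : plane R => (c * \1_A x)%:E).
  exact: measurable_scaled_indic.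
pose z := 1 + h / eta; have z1 : 0 <= z by rewrite addr_ge0.
have zi : 0 <= z * eta^-1 by exact: mulr_ge0.
have zk : 0 <= z * (D ^+ 2 / 8) by rewrite mulr_ge0// divr_ge0// sqr_ge0.
(* Adding back the subtracted term leaves a sum of nonnegative functions. *)
have e1 : (\int[P]_x (majorant x + z * (D ^+ 2 / 8) * \1_B x)%:E =
    (z * (1 + eta^-1 * pr S + eta^-1 * pr S0))%:E)%E.
  under eq_integral => x _.
    have -> : majorant x + z * (D ^+ 2 / 8) * \1_B x =
      z * \1_setT x + (z * eta^-1 * \1_S x + z * eta^-1 * \1_S0 x).
      by rewrite /majorant -/z indicT /cst; ring.
    rewrite EFinD EFinD; over.
  rewrite ge0_integralD//=; first last.
  - by apply: emeasurable_funD; exact: mc.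
  - by move=> x _; rewrite -EFinD lee_fin addr_ge0// mulr_ge0.
  - exact: mc.
  - by move=> x _; rewrite lee_fin mulr_ge0.
  rewrite ge0_integralD//=; first last.
  - exact: mc.
  - by move=> x _; rewrite lee_fin mulr_ge0.
  - exact: mc.
  - by move=> x _; rewrite lee_fin mulr_ge0.
  rewrite !ind// -!EFinD; congr EFin.
  have -> : pr [set: plane R] = 1.
    have := prE (@measurableT _ (plane R)); rewrite probability_setT => -[] //.
  by ring.
have e2 : (\int[P]_x (majorant x + z * (D ^+ 2 / 8) * \1_B x)%:E =
    \int[P]_x (majorant x)%:E + (z * (D ^+ 2 / 8) * pr B)%:E)%E.
  under eq_integral => x _ do rewrite EFinD.
  rewrite ge0_integralD//=; first by rewrite ind.
  - by move=> x _; rewrite lee_fin majorant_ge0.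
  - by apply/measurable_EFinP; exact: measurable_majorant.
  - by move=> x _; rewrite lee_fin mulr_ge0.
  - exact: mc.
move: e1; rewrite e2 => e1.
have -> : (\int[P]_x (majorant x)%:E = (z * (1 + eta^-1 * pr S + eta^-1 * pr S0) -
    z * (D ^+ 2 / 8) * pr B)%:E)%E.
  by rewrite EFinB -e1 addeK.
rewrite lee_fin -[X in expR X]addrA expRD.
apply: (@le_trans _ _ (z * (1 + ((pr S + pr S0) / eta - D ^+ 2 / 8 * pr B)))).
  by rewrite le_eqVlt; apply/orP; left; apply/eqP; ring.
apply: (@le_trans _ _ (z * expR ((pr S + pr S0) / eta - D ^+ 2 / 8 * pr B))).
  by rewrite ler_wpM2l// expR_ge1Dx.
by rewrite ler_wpM2r ?expR_ge0// expR_ge1Dx.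
Qed.

(** The [n]-th power of the integral for one observation, bounded through
    [1 + u <= exp u]. *)
Lemma integral_majorant_prod n :
  (\int[iid (uniform_square (@ltr01 R)) n]_X
     (\prod_(i < n) majorant (tnth X i))%:E <=
   (expR (n%:R * (h / eta + (pr S + pr S0) / eta - D ^+ 2 / 8 * pr B)))%:E)%E.
Proof.
rewrite (@integral_iid_prod _ _ _ _ n (fun=> majorant)).
- have := integral_majorant; set v := (\int[_]_x _)%E; set e := expR _ => ve.
  have v0 : (0 <= v)%E by apply: integral_ge0 => x _; rewrite lee_fin majorant_ge0.
  have : v \is a fin_num by rewrite ge0_fin_numE// (le_lt_trans ve)// ltry.
  move=> /fineK vE; rewrite -vE in v0 ve *; rewrite !lee_fin in v0 ve.
  rewrite prodEFin lee_fin prodr_const card_ord expRM_natl.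
  by rewrite lerXn2r// nnegrE expR_ge0.
- by move=> _; exact: measurable_majorant.
- by move=> _ x; exact: majorant_ge0.
Qed.

End Affinity.

(** * Evidence of a fixed number of vertices *)
Section Support.
Context {R : realType}.
Variables (eta : R) (heta : 0 < eta < 1 / 2).
Local Notation Q := (uniform_square (eta_lt heta)).

Definition inner_square : set (plane R) := `[eta, 1 - eta] `*` `[eta, 1 - eta].

Lemma measurable_inner_square : measurable inner_square.
Proof. by apply: measurableX; exact: measurable_itv. Qed.

Lemma uniform_inner_square : Q inner_square = 1%E.
Proof.
have e : uniform_prob (eta_lt heta) `[eta, (1 - eta)%R] = 1%E.
  rewrite uniform_prob_itv ?lexx ?eta_lt// divff// subr_eq0 gt_eqF//.
  exact: eta_lt.
rewrite /uniform_square /= product_measure1E//.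
by transitivity (1 * 1 : \bar R)%E; [congr (_ * _)%E|rewrite mule1].
Qed.

(** It carries the prior, so that likelihoods need bounding there only; elsewhere
    they might even be negative. *)
Definition draws_in k : set ((measurableTypeR R * measurableTypeR R) * k.-tuple (plane R)) :=
  inner_square `*` [set w | forall i, inner_square (tnth w i)].

Lemma measurable_draws_in k : measurable (@draws_in k).
Proof.
apply: measurableX; first exact: measurable_inner_square.
by apply: (@measurable_iid_box _ _ k (fun=> inner_square)) => i;
  exact: measurable_inner_square.
Qed.

Lemma draw_law_off_support k : draw_law heta k (~` @draws_in k) = 0%E.
Proof.
have mS := @measurable_draws_in k.
suff S1 : draw_law heta k (@draws_in k) = 1%E.
  by rewrite probability_setC// S1 subee.
rewrite /draw_law /= product_measure1E; last 2 first.
- exact: measurable_inner_square.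
- by apply: (@measurable_iid_box _ _ k (fun=> inner_square)) => i;
    exact: measurable_inner_square.
transitivity (1 * 1 : \bar R)%E; last by rewrite mule1.
congr (_ * _)%E; first exact: uniform_inner_square.
apply: (etrans (@iid_box _ _ R Q k (fun=> inner_square) _)).
  by move=> i; exact: measurable_inner_square.
by rewrite big1// => i _; exact: uniform_inner_square.
Qed.

Lemma draws_in_rates k w : @draws_in k w -> rates_in eta (draw_param w).
Proof. by move=> [[/= ? ?] _]. Qed.

Lemma cell2_cover M (p : plane R) : (0 < M)%N -> inner_square p ->
  exists a : 'I_M * 'I_M, cell2 eta a p.
Proof.
move=> M0 [/(cell1_cover heta M0)[a ap] /(cell1_cover heta M0)[b bp]].
by exists (a, b).
Qed.

Lemma tuple_cover M k (w : k.-tuple (plane R)) : (0 < M)%N ->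
  (forall i, inner_square (tnth w i)) ->
  exists b : k.-tuple ('I_M * 'I_M), forall i, cell2 eta (tnth b i) (tnth w i).
Proof.
move=> M0 sw; have [f fP] := fin_all_exists (fun i => cell2_cover M0 (sw i)).
by exists (mktuple f) => i; rewrite tnth_mktuple.
Qed.

Lemma cell_cover M k w : (0 < M)%N -> @draws_in k w ->
  exists j : ('I_M * 'I_M) * k.-tuple ('I_M * 'I_M), cell eta j w.
Proof.
move=> M0 [/(cell2_cover M0)[a aw] /(tuple_cover M0)[b bw]].
by exists (a, b).
Qed.

End Support.

Section Marginal.
Context {R : realType}.
Variables (eta : R) (heta : 0 < eta < 1 / 2).
Variables (n : nat) (x : n.-tuple (plane R)) (y : n.-tuple bool).
Implicit Type D : set (param R).

(** Prior integral of the likelihood over the [k]-point hulls with a parameter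
    in [D]. *)
Definition evidence k D : \bar R :=
  (\int[draw_law heta k]_(w in [set w | D (draw_param w)])
     (likelihood (draw_param w) x y)%:E)%E.

Let lik k (w : (measurableTypeR R * measurableTypeR R) * k.-tuple (plane R)) : \bar R :=
  (likelihood (draw_param w) x y)%:E.

Let off k := measurableC (@measurable_draws_in R eta k).

Let lik01 k w : ~ (~` @draws_in R eta k) w -> (0 <= lik w <= 1)%E.
Proof.
move/contrapT/draws_in_rates => r.
by rewrite !lee_fin (likelihood_le1 heta)// ltW// (likelihood_gt0 heta).
Qed.

Lemma evidence_ge0 k D : (0 <= evidence k D)%E.
Proof.
rewrite /evidence integral_mkcond -[leLHS](integral0 (draw_law heta k) setT).
apply: (integral_ge_off_null (@off k) (draw_law_off_support heta k)) => //.
move=> w /lik01/andP[l0 _]; rewrite patchE; case: ifP => // _; exact: l0.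
Qed.

Lemma evidence_le1 k D : (evidence k D <= 1)%E.
Proof.
rewrite -[leRHS](@probability_setT _ _ _ (draw_law heta k)) -[leRHS]mul1e.
rewrite -[X in (_ <= X * _)%E]/(1%:E) -integral_cst//.
apply: (integral_le_off_null (@off k) (draw_law_off_support heta k)) => //.
by move=> w /lik01/andP[_ l1] _.
Qed.

Lemma evidence_fin k D : evidence k D \is a fin_num.
Proof. by rewrite ge0_fin_numE ?evidence_ge0// (le_lt_trans (evidence_le1 k D))// ltry. Qed.

Lemma evidence_le_setT k D : (evidence k D <= evidence k setT)%E.
Proof.
rewrite (_ : evidence k setT = \int[draw_law heta k]_w lik w)%E; last first.
  by rewrite /evidence; congr integral; apply/seteqP; split.
apply: (integral_subset_off_null _ (@off k) (draw_law_off_support heta k)).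
by move=> w /lik01/andP[].
Qed.

Variables (M : nat) (M0 : (0 < M)%N).

(** The simple function equal to the sum over [j] of [c j] on the cell [j]
    dominates the integrand almost surely; cells without a parameter in [D] may
    be given [c j = 0]. *)
Lemma evidence_cover k D (c : ('I_M * 'I_M) * k.-tuple ('I_M * 'I_M) -> R) :
  (forall j, 0 <= c j) ->
  (forall j w, @draws_in R eta k w -> cell eta j w -> D (draw_param w) ->
     likelihood (draw_param w) x y <= c j) ->
  (evidence k D <= (\sum_j c j * M%:R^-1 ^+ (2 * k.+1))%:E)%E.
Proof.
move=> c0 cP.
pose g w : \bar R := (\sum_j (c j * \1_(cell eta j) w)%:E)%E.
have mg : measurable_fun setT g.
  by apply: emeasurable_sum => j; apply: measurable_scaled_indic; exact: measurable_cell.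
apply: (@le_trans _ _ (\int[draw_law heta k]_w g w)%E).
  apply: (integral_le_off_null (@off k) (draw_law_off_support heta k) mg).
    by move=> w; rewrite /g; apply: sume_ge0 => j _; rewrite lee_fin mulr_ge0.
  move=> w /contrapT sw Dw.
  have [j wj] := cell_cover heta M0 sw.
  rewrite /g sumEFin lee_fin (bigD1 j)//= indicE mem_set// mulr1.
  apply: le_trans (cP _ _ sw wj Dw) _; rewrite lerDl sumr_ge0// => i _.
  by rewrite mulr_ge0.
rewrite /g ge0_integral_sum//=; last 2 first.
- by move=> j; apply: measurable_scaled_indic; exact: measurable_cell.
- by move=> j w _; rewrite lee_fin mulr_ge0.
rewrite -sumEFin; apply: lee_sum => j _.
rewrite EFinM -(draw_law_cell heta M0 j).
by rewrite le_eqVlt; apply/orP; left; apply/eqP; apply: integral_scaled_indic => //;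
  exact: measurable_cell.
Qed.

Lemma evidence_lower k (j : ('I_M * 'I_M) * k.-tuple ('I_M * 'I_M)) (c : R) :
  0 <= c ->
  (forall w, @draws_in R eta k w -> cell eta j w -> c <= likelihood (draw_param w) x y) ->
  ((c * M%:R^-1 ^+ (2 * k.+1))%:E <= evidence k setT)%E.
Proof.
move=> c0 cP; have mc := measurable_cell eta j.
rewrite EFinM -(draw_law_cell heta M0 j).
have <- : (\int[draw_law heta k]_w (c * \1_(cell eta j) w)%:E =
    c%:E * draw_law heta k (cell eta j))%E.
  exact: integral_scaled_indic.
rewrite /evidence (_ : mkset _ = setT); last by apply/seteqP; split.
apply: (integral_ge_off_null (@off k) (draw_law_off_support heta k)).
- exact: measurable_scaled_indic.
- by move=> w; rewrite lee_fin mulr_ge0.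
move=> w nsw; have sw := contrapT nsw; rewrite lee_fin indicE.
have [/set_mem wj|_] := boolP (w \in _); first by rewrite mulr1; exact: cP.
by rewrite mulr0; have /andP[+ _] := lik01 nsw; rewrite /lik lee_fin.
Qed.

End Marginal.

(** * Model weights and the posterior as a series *)
Section ModelPrior.
Context {R : realType}.
Variables (c : R) (c1 : 1 <= c) (n : nat) (n0 : (0 < n)%N).

Definition logen : R := ln (expR 1 * n%:R).

Lemma logenE : logen = 1 + ln n%:R.
Proof. by rewrite /logen lnM ?posrE ?expR_gt0 ?ltr0n// expRK. Qed.

Lemma logen_ge1 : 1 <= logen.
Proof. by rewrite logenE lerDl ln_ge0// ler1n. Qed.

Lemma model_weight_gt0 k : 0 < model_weight c n k.
Proof. exact: expR_gt0. Qed.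

Lemma expR_half k : expR (- k%:R) <= (2 ^ k)%:R^-1 :> R.
Proof.
rewrite expRN lef_pV2 ?posrE ?expR_gt0 ?ltr0n ?expn_gt0//.
rewrite natrX -[k%:R]mulr1 expRM_natl lerXn2r ?nnegrE ?expR_ge0//.
by have := expR_ge1Dx (1 : R).
Qed.

Lemma model_weight_le k : model_weight c n k <= (2 ^ k)%:R^-1.
Proof.
apply: le_trans (expR_half k); rewrite /model_weight ler_expR lerN2 -/logen.
by rewrite mulrAC -[leLHS]mul1r ler_wpM2r// mulr_ege1// logen_ge1.
Qed.

Lemma geometric_series_le1 (f : nat -> R) : (forall i, 0 <= f i) ->
  (forall i, f i <= (2 ^ i.+1)%:R^-1) -> (\sum_(i <oo) (f i)%:E <= 1)%E.
Proof.
move=> f0 f1; have := @epsilon_trick0 R 1 xpredT ler01; apply: le_trans.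
by apply: lee_nneseries => i _ //; rewrite lee_fin ?f0// mul1r.
Qed.

(** Normalizing constant of the model prior. *)
Definition weight_sum : \bar R := (\sum_(1 <= k <oo) (model_weight c n k)%:E)%E.

Lemma weight_sum_le1 : (weight_sum <= 1)%E.
Proof.
rewrite /weight_sum -(@nneseries_addn R _ 1); last by move=> i; rewrite lee_fin ltW// model_weight_gt0.
under eq_eseriesr do rewrite addn1.
apply: (@geometric_series_le1 (fun i => model_weight c n i.+1)) => i.
  exact/ltW/model_weight_gt0.
exact: model_weight_le.
Qed.

Lemma weight_sum_gt0 : (0 < weight_sum)%E.
Proof.
have := @nneseries_lim_ge R (fun k => (model_weight c n k)%:E) xpredT 1 2.
rewrite big_nat1; move=> h; apply: lt_le_trans (h _); last first.
  by move=> i _ _; rewrite lee_fin ltW// model_weight_gt0.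
by rewrite lte_fin model_weight_gt0.
Qed.

Lemma weight_sum_fine : 0 < fine weight_sum.
Proof.
rewrite fine_gt0// weight_sum_gt0/=.
by apply: le_lt_trans weight_sum_le1 _; rewrite ltry.
Qed.

Lemma model_prior_gt0 k : 0 < model_prior c n k.
Proof. by rewrite /model_prior divr_gt0 ?model_weight_gt0// weight_sum_fine. Qed.

Lemma model_prior_ratio k l :
  model_prior c n k / model_prior c n l = expR (c * (l%:R - k%:R) * logen).
Proof.
rewrite /model_prior -/weight_sum invfM invrK mulrACA.
rewrite [_^-1 * _]mulVf ?mulr1; last by rewrite gt_eqF// weight_sum_fine.
by rewrite /model_weight -expRN -expRD -/logen; congr expR; ring.
Qed.

Lemma model_prior_sum : (\sum_(i <oo) (model_prior c n i.+1)%:E <= 1)%E.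
Proof.
have -> : (\sum_(i <oo) (model_prior c n i.+1)%:E =
    ((fine weight_sum)^-1)%:E * weight_sum)%E.
  rewrite {2}/weight_sum -(@nneseries_addn R _ 1); last by move=> i; rewrite lee_fin ltW// model_weight_gt0.
  rewrite -nneseriesZl; last by move=> i _; rewrite lee_fin ltW// model_weight_gt0.
  by apply: eq_eseriesr => i _; rewrite addn1 -EFinM mulrC.
have f : weight_sum \is a fin_num.
  rewrite ge0_fin_numE; last exact/ltW/weight_sum_gt0.
  by apply: le_lt_trans weight_sum_le1 _; rewrite ltry.
by rewrite -{2}(fineK f) -EFinM mulVf// gt_eqF// weight_sum_fine.
Qed.

End ModelPrior.

Section PosteriorSeries.
Context {R : realType}.
Variables (eta : R) (heta : 0 < eta < 1 / 2).
Variables (c : R) (c1 : 1 <= c) (n : nat) (n0 : (0 < n)%N).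
Variables (x : n.-tuple (plane R)) (y : n.-tuple bool).
Implicit Type D : set (param R).

Local Notation lambda := (model_prior c n).
Local Notation ev k D := (fine (evidence heta x y k D)).

Let integ D := prior_integral heta c n D (fun th => likelihood th x y).

Lemma prior_integralE D : integ D = (\sum_(i <oo) (lambda i.+1 * ev i.+1 D)%:E)%E.
Proof.
rewrite /integ /prior_integral -(@nneseries_addn R _ 1); last first.
  move=> i; apply: mule_ge0; first by rewrite lee_fin ltW// model_prior_gt0.
  exact: (evidence_ge0 heta x y i D).
apply: eq_eseriesr => i _; rewrite addn1 [RHS]EFinM fineK//; exact: evidence_fin.
Qed.

Let term_ge0 D i : 0 <= lambda i.+1 * ev i.+1 D.
Proof.
apply: mulr_ge0; first exact/ltW/model_prior_gt0.
by rewrite fine_ge0// evidence_ge0.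
Qed.

Lemma prior_integral_ge0 D : (0 <= integ D)%E.
Proof. by rewrite prior_integralE; apply: nneseries_ge0 => i _ _; rewrite lee_fin. Qed.

Lemma prior_integral_le1 D : (integ D <= 1)%E.
Proof.
rewrite prior_integralE; apply: le_trans (model_prior_sum c1 n0).
apply: lee_nneseries => i _; first by move=> _; rewrite lee_fin.
rewrite lee_fin ler_piMr//; first exact/ltW/model_prior_gt0.
rewrite -lee_fin fineK ?evidence_fin//.
exact: evidence_le1.
Qed.

Lemma prior_integral_fin D : integ D \is a fin_num.
Proof.
by rewrite ge0_fin_numE ?prior_integral_ge0// (le_lt_trans (prior_integral_le1 D))// ltry.
Qed.

Definition marginal : R := fine (integ setT).

(** One term of a series of nonnegative terms. *)
Lemma marginal_ge i : lambda i.+1 * ev i.+1 setT <= marginal.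
Proof.
rewrite -lee_fin /marginal fineK ?prior_integral_fin// prior_integralE.
have := @nneseries_lim_ge R (fun k => (lambda k.+1 * ev k.+1 setT)%:E) xpredT 0 i.+1.
rewrite big_nat_recr//= => h; apply: le_trans (h _); last by move=> k _ _; rewrite lee_fin.
by rewrite leeDr// sume_ge0// => k _; rewrite lee_fin.
Qed.

(** Posterior probability that the parameter is in [D] and the hull is spanned
    by [i.+1] points. *)
Definition post_term D i : R := lambda i.+1 * ev i.+1 D / marginal.

Lemma marginal_ge0 : 0 <= marginal.
Proof. by rewrite fine_ge0// prior_integral_ge0. Qed.

Lemma post_term_ge0 D i : 0 <= post_term D i.
Proof. by rewrite /post_term divr_ge0// marginal_ge0. Qed.

Lemma post_term_le1 D i : post_term D i <= 1.
Proof.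
rewrite /post_term; have := marginal_ge0; rewrite le_eqVlt => /orP[/eqP <-|m0].
  by rewrite invr0 mulr0.
rewrite ler_pdivrMr// mul1r; apply: le_trans (marginal_ge i).
rewrite ler_wpM2l//; first exact/ltW/model_prior_gt0.
by rewrite -lee_fin !fineK ?evidence_fin// evidence_le_setT.
Qed.

Lemma posterior_series D :
  ((posterior heta c D x y)%:E = \sum_(i <oo) (post_term D i)%:E)%E.
Proof.
have -> : (\sum_(i <oo) (post_term D i)%:E = marginal^-1%:E * integ D)%E.
  rewrite prior_integralE -nneseriesZl; last by move=> i _; rewrite lee_fin.
  by apply: eq_eseriesr => i _; rewrite -EFinM mulrC.
have -> : posterior heta c D x y = fine (integ D) / marginal by [].
by rewrite EFinM (fineK (prior_integral_fin D)) muleC.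
Qed.

End PosteriorSeries.

Lemma ler_sqrt_sum (R : rcfType) (I : Type) (r : seq I) (P : pred I) (f : I -> R) :
  (forall i, P i -> 0 <= f i) ->
  Num.sqrt (\sum_(i <- r | P i) f i) <= \sum_(i <- r | P i) Num.sqrt (f i).
Proof.
move=> f0; have H (a b : R) : 0 <= a -> 0 <= b ->
    Num.sqrt (a + b) <= Num.sqrt a + Num.sqrt b.
  move=> a0 b0; have sa := sqrtr_ge0 a; have sb := sqrtr_ge0 b.
  rewrite -[leRHS]ger0_norm ?addr_ge0// -sqrtr_sqr ler_wsqrtr//.
  by rewrite sqrrD !sqr_sqrtr// lerD2r lerDl mulrn_wge0// mulr_ge0.
elim: r => [|i r IH]; first by rewrite !big_nil sqrtr0.
rewrite !big_cons; case: ifP => // Pi.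
apply: le_trans (H _ _ (f0 _ Pi) (sumr_ge0 _ _)) _ => //.
by rewrite lerD2l.
Qed.

Lemma le_sqrtr01 (R : rcfType) (a : R) : 0 <= a -> a <= 1 -> a <= Num.sqrt a.
Proof.
move=> a0 a1; rewrite -[leLHS]ger0_norm// -sqrtr_sqr ler_wsqrtr// expr2.
by rewrite ler_piMl.
Qed.

(** * Posterior mass of a set through cells *)
Section Cells.
Context {R : realType}.
Variables (eta : R) (heta : 0 < eta < 1 / 2) (M : nat) (M0 : (0 < M)%N).
Local Notation h := (mesh eta M).

Lemma cell_near k (j : ('I_M * 'I_M) * k.-tuple ('I_M * 'I_M)) w w' :
  cell eta j w -> cell eta j w' ->
  near_pt h w.1 w'.1 /\ forall i, near_pt h (tnth w.2 i) (tnth w'.2 i).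
Proof.
move=> [[a1 a2] b] [[a1' a2'] b']; split; first by split; [exact: cell1_dist a1 a1'|exact: cell1_dist a2 a2'].
move=> i; have [c1 c2] := b i; have [c1' c2'] := b' i.
by split; [exact: cell1_dist c1 c1'|exact: cell1_dist c2 c2'].
Qed.

(** Two draws in the same cell have vertices within the mesh of each other, so
    their hulls agree off the strips of either. *)
Lemma likelihood_cell k (j : ('I_M * 'I_M) * k.-tuple ('I_M * 'I_M)) w w0 n
    (x : n.-tuple (plane R)) y :
  @draws_in R eta k w -> draws_in eta w0 -> cell eta j w -> cell eta j w0 ->
  likelihood (draw_param w) x y <= likelihood (draw_param w0) x y *
    \prod_(i < n) tilt eta h (edge_strips w0.2 h) (tnth x i).
Proof.
move=> sw sw0 jw jw0; have [[d1 d2] nv] := cell_near jw jw0.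
apply: (likelihood_le_tilt heta) => //.
- exact/ltW/mesh_gt0.
- exact: draws_in_rates.
- exact: draws_in_rates.
- by move=> z nz; apply: hull_perturb nz.
Qed.

Variables (th0 : param R) (r0 : rates_in eta th0).
Variables (k : nat) (w0 : (measurableTypeR R * measurableTypeR R) * k.-tuple (plane R))
  (sw0 : draws_in eta w0) (w01 : w0.1 = th0.1).

(** Where a draw near [w0] may disagree with the truth: either it disagrees with
    the hull of [w0], or this hull does. *)
Definition base_region : set (plane R) :=
  edge_strips w0.2 h `|` (hull [set` w0.2] `+` th0.2).

Lemma measurable_base_region : measurable th0.2 -> measurable base_region.
Proof.
move=> m0; apply: measurableU; first exact: measurable_edge_strips.
by apply: measurableY => //; exact: measurable_hull.
Qed.

(** The likelihood stays comparable with the one at the truth on a whole cell,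
    which bounds the marginal likelihood from below. *)
Lemma likelihood_base (j : ('I_M * 'I_M) * k.-tuple ('I_M * 'I_M)) w n
    (x : n.-tuple (plane R)) y :
  draws_in eta w -> cell eta j w -> cell eta j w0 ->
  likelihood th0 x y / \prod_(i < n) tilt eta h base_region (tnth x i) <=
    likelihood (draw_param w) x y.
Proof.
move=> sw jw jw0; have [[d1 d2] nv] := cell_near jw0 jw.
have t0 : 0 < \prod_(i < n) tilt eta h base_region (tnth x i).
  apply: prodr_gt0 => i _; apply: lt_le_trans ltr01 _; apply: tilt_ge1 => //.
  exact/ltW/mesh_gt0.
rewrite ler_pdivrMr//; apply: (likelihood_le_tilt heta) => //.
- exact/ltW/mesh_gt0.
- exact: draws_in_rates.
- by rewrite -w01.
- by rewrite -w01.
move=> z nz.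
have nz1 : ~ edge_strips w0.2 h z by move=> ?; apply: nz; left.
have nz2 : ~ (hull [set` w0.2] `+` th0.2) z by move=> ?; apply: nz; right.
have wn i : near_pt h (tnth w.2 i) (tnth w0.2 i) by exact/near_ptC.
have e := hull_perturb wn nz1; move: nz2; rewrite setY_def => nz2.
split => H; apply: contrapT => H'; apply: nz2; [right|left]; split => //.
  by move/e/H'.
exact/e.
Qed.

End Cells.

Section CellMajorant.
Context {R : realType}.
Variables (eta : R) (heta : 0 < eta < 1 / 2).
Variables (th0 : param R) (r0 : rates_in eta th0) (m0 : measurable th0.2)
  (sub0 : th0.2 `<=` inner_square eta).
Variables (h : R) (h0 : 0 <= h) (S0 : set (plane R)) (mS0 : measurable S0).

(** The constant [D ^ 2 / 8] of the affinity bound for [D] a quarter of the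
    distance between the true rates, times the factor [eta] of
    [discriminate]. *)
Definition hellinger_rate : R := (`|th0.1.1 - th0.1.2| / 4) ^+ 2 / 8 * eta.

Lemma inner_square_convex : convex_plane (inner_square eta).
Proof.
apply/convex_planeP => -[p1 p2] [q1 q2] t t0 t1.
rewrite /inner_square /mix /px /py /= !in_itv/=.
move=> [/andP[? ?] /andP[? ?]] [/andP[? ?] /andP[? ?]].
by split; apply/andP; split; nra.
Qed.

Lemma inner_square_unit : inner_square eta `<=` unit_square.
Proof.
case/andP: heta => ? ? x.
rewrite /inner_square /unit_square /= !in_itv/= => -[/andP[? ?] /andP[? ?]].
by split; apply/andP; split; lra.
Qed.

Lemma hull_inner k (w : k.-tuple (plane R)) :
  (forall i, inner_square eta (tnth w i)) -> hull [set` w] `<=` inner_square eta.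
Proof.
by move=> sw; apply: hull_min inner_square_convex _ => _ /= /tnthP[i ->].
Qed.

Lemma inner_px x : inner_square eta x -> eta <= px x.
Proof. by move=> [/= + _]; rewrite in_itv/= => /andP[]. Qed.

(** Logarithm of the bound on the expected square root of the likelihood ratio
    of a cell containing [w]. *)
Definition log_bound n k (w : k.-tuple (plane R)) : R :=
  n%:R * (h / eta + (pr (edge_strips w h) + pr S0) / eta -
    hellinger_rate * Num.min (pr (hull [set` w] `+` th0.2)) (pr th0.2)).

(** Chooses a discriminating region for the draw [w] and hides it. *)
Lemma cell_majorant n k w : @draws_in R eta k w -> exists g : plane R -> R,
  [/\ measurable_fun setT g, forall x, 0 <= g x,
    forall X : n.-tuple (plane R), \sum_(y : n.-tuple bool) likelihood th0 X y *
      Num.sqrt (\prod_(i < n) tilted_ratio eta th0 (draw_param w) h S0 (edge_strips w.2 h)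
         (tnth X i) (tnth y i)) <= \prod_(i < n) g (tnth X i) &
    (\int[iid (uniform_square (@ltr01 R)) n]_X (\prod_(i < n) g (tnth X i))%:E <=
      (expR (log_bound n w.2))%:E)%E].
Proof.
move=> sw; have rw := draws_in_rates sw.
have mS : measurable (edge_strips w.2 h) by exact: measurable_edge_strips.
have mw : measurable (draw_param w).2 by exact: measurable_hull.
have in0 x : th0.2 x -> eta <= px x by move=> /sub0 /inner_px.
have inw x : (draw_param w).2 x -> eta <= px x.
  by case: (sw) => _ /= sw2 /(hull_inner sw2) /inner_px.
have [B [mB Bd Bp]] := discriminate heta r0 rw m0 mw in0 inw.
have D0 : 0 <= `|th0.1.1 - th0.1.2| / 4 by rewrite divr_ge0.
exists (majorant eta h S0 (edge_strips w.2 h) B (`|th0.1.1 - th0.1.2| / 4)).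
split.
- exact: measurable_majorant.
- by move=> x; apply: (majorant_ge0 heta r0 rw).
- by move=> X; apply: (sum_sqrt_ratio heta r0 rw).
apply: le_trans (integral_majorant_prod heta r0 rw h0 D0 Bd mS0 mS mB n) _.
rewrite lee_fin ler_expR /log_bound ler_wpM2l// lerD2l lerN2 /hellinger_rate.
rewrite -[leLHS]mulrA.
by rewrite ler_wpM2l// divr_ge0// sqr_ge0.
Qed.

End CellMajorant.

Section PosteriorBound.
Context {R : realType}.
Variables (eta : R) (heta : 0 < eta < 1 / 2).
Variables (c : R) (c1 : 1 <= c) (n : nat) (n0 : (0 < n)%N) (M : nat) (M0 : (0 < M)%N).
Variables (th0 : param R) (r0 : rates_in eta th0) (m0 : measurable th0.2)
  (sub0 : th0.2 `<=` inner_square eta).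
Variables (s : nat) (w0 : (measurableTypeR R * measurableTypeR R) * s.+1.-tuple (plane R))
  (sw0 : draws_in eta w0) (w01 : w0.1 = th0.1).
Local Notation h := (mesh eta M).
Local Notation S0 := (base_region eta M th0 w0).
Local Notation J k := (('I_M * 'I_M) * k.-tuple ('I_M * 'I_M))%type.
Local Notation lambda := (model_prior c n).
Local Notation W k := ((measurableTypeR R * measurableTypeR R) * k.-tuple (plane R))%type.

Let h0 : 0 <= h. Proof. exact/ltW/mesh_gt0. Qed.

(** Prior odds of one cell of [i.+1] vertices against one cell of [s.+1]
    vertices. *)
Definition cell_odds i : R :=
  lambda i.+1 * M%:R^-1 ^+ (2 * i.+2) / (lambda s.+1 * M%:R^-1 ^+ (2 * s.+2)).

Let cell_odds_ge0 i : 0 <= cell_odds i.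
Proof.
have Mi k : 0 <= M%:R^-1 ^+ k :> R by rewrite exprn_ge0// invr_ge0.
by rewrite /cell_odds divr_ge0// mulr_ge0// ltW// model_prior_gt0.
Qed.

Variable U : set (param R).

Let good i (j : J i.+1) : bool :=
  `[< exists w : W i.+1, [/\ draws_in eta w, cell eta j w & U (draw_param w)] >].

Let rep i (j : J i.+1) : W i.+1 :=
  xget point [set w | [/\ draws_in eta w, cell eta j w & U (draw_param w)]].

Let repP i (j : J i.+1) : good j ->
  [/\ draws_in eta (rep j), cell eta j (rep j) & U (draw_param (rep j))].
Proof. by move=> /asboolP[w wP]; rewrite /rep; case: xgetP => [w' _ //|/(_ w)]. Qed.

Let tprod (x : n.-tuple (plane R)) S := \prod_(l < n) tilt eta h S (tnth x l).

Let tprod_gt0 x S : 0 < tprod x S.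
Proof.
apply: prodr_gt0 => i _; apply: lt_le_trans ltr01 _; exact: tilt_ge1.
Qed.

Let rprod i (j : J i.+1) (x : n.-tuple (plane R)) (y : n.-tuple bool) :=
  \prod_(l < n) tilted_ratio eta th0 (draw_param (rep j)) h S0
    (edge_strips (rep j).2 h) (tnth x l) (tnth y l).

Let rprodE i (j : J i.+1) x y : rprod j x y =
  likelihood (draw_param (rep j)) x y * tprod x (edge_strips (rep j).2 h) *
  tprod x S0 / likelihood th0 x y.
Proof.
by rewrite !likelihoodE /rprod /tprod -prodfV -!big_split/=.
Qed.

Let rprod_ge0 i (j : J i.+1) x y : good j -> 0 <= rprod j x y.
Proof.
move=> /repP[sw _ _]; apply: prodr_ge0 => l _; apply: tilted_ratio_ge0 => //.
exact: draws_in_rates.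
Qed.

(** The numerator is covered by the cells meeting [U], each represented by one
    of its draws in [U]; the marginal likelihood is at least the share of the
    cell of [w0]. *)
Lemma post_term_le x y i : post_term heta c x y U i <=
  \sum_(j : J i.+1 | good j) cell_odds i * rprod j x y.
Proof.
have L0 : 0 < likelihood th0 x y by exact: (likelihood_gt0 heta).
have [j0 jw0] := cell_cover heta M0 sw0.
have lam k : 0 < lambda k by exact: model_prior_gt0.
have low := @evidence_lower R eta heta n x y M M0 s.+1 j0
  (likelihood th0 x y / tprod x S0).
have {}low : likelihood th0 x y / tprod x S0 * M%:R^-1 ^+ (2 * s.+2) <=
    fine (evidence heta x y s.+1 setT).
  rewrite -lee_fin fineK ?evidence_fin//; apply: low.
    by rewrite divr_ge0// ltW.
  by move=> w sw jw; exact: (likelihood_base heta M0 r0 w01 x y sw jw jw0).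
have mlow : lambda s.+1 * (likelihood th0 x y / tprod x S0 * M%:R^-1 ^+ (2 * s.+2)) <=
    marginal heta c x y.
  apply: le_trans (marginal_ge heta c1 n0 x y s).
  by rewrite ler_wpM2l// ltW.
pose cj (j : J i.+1) := if good j then likelihood (draw_param (rep j)) x y *
  tprod x (edge_strips (rep j).2 h) else 0.
have up : fine (evidence heta x y i.+1 U) <= \sum_j cj j * M%:R^-1 ^+ (2 * i.+2).
  rewrite -lee_fin fineK ?evidence_fin//.
  apply: evidence_cover => // [j|j w sw jw Uw]; rewrite /cj.
    case: ifP => // /repP[sr _ _]; rewrite mulr_ge0 ?ltW ?tprod_gt0//.
    by apply: (likelihood_gt0 heta) => //; exact: draws_in_rates.
  have gj : good j by apply/asboolP; exists w.
  by rewrite gj; have [sr jr _] := repP gj; exact: (likelihood_cell heta M0 x y sw sr jw jr).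
have den0 : 0 < lambda s.+1 * (likelihood th0 x y / tprod x S0 * M%:R^-1 ^+ (2 * s.+2)).
  rewrite mulr_gt0// mulr_gt0 ?divr_gt0// exprn_gt0// invr_gt0 ltr0n//.
rewrite /post_term; apply: (@le_trans _ _ (lambda i.+1 * (\sum_j cj j * M%:R^-1 ^+ (2 * i.+2)) /
  (lambda s.+1 * (likelihood th0 x y / tprod x S0 * M%:R^-1 ^+ (2 * s.+2))))).
  apply: ler_pM.
  - by apply: mulr_ge0; [exact: ltW (lam _)|rewrite fine_ge0// evidence_ge0].
  - by rewrite invr_ge0; exact: marginal_ge0.
  - by apply: ler_wpM2l up; exact: ltW (lam _).
  - by rewrite lef_pV2 ?posrE//; exact: lt_le_trans mlow.
rewrite le_eqVlt; apply/orP; left; apply/eqP.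
rewrite [RHS]big_mkcond/= mulr_sumr mulr_suml; apply: eq_bigr => j _.
rewrite /cj; case: ifP => _; last by rewrite mul0r mulr0 mul0r.
have := tprod_gt0 x S0; have := lam s.+1.
have MM : M%:R != 0 :> R by rewrite pnatr_eq0 -lt0n.
rewrite rprodE /cell_odds; move: (tprod x S0) => T T0 l0 .
have Mp : M%:R^-1 ^+ (2 * s.+2) != 0 :> R by rewrite expf_neq0// invr_eq0.
move: (M%:R^-1 ^+ (2 * s.+2)) Mp => q Mp.
by field; rewrite Mp !gt_eqF.
Qed.

Definition tail_bound (T : nat -> R) := forall i (w : W i.+1), draws_in eta w ->
  U (draw_param w) ->
  Num.sqrt (cell_odds i) * M%:R ^+ (2 * i.+2) * expR (log_bound eta th0 h S0 n w.2) <= T i.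

(** Each term of the posterior is at most one, hence at most its square root,
    and the square root of a sum over cells is at most the sum of the square
    roots.  There are [M ^ (2 * i.+2)] cells, which explains the factor in
    [tail_bound]. *)
Lemma expect_posterior_le (T : nat -> R) : (forall i, 0 <= T i) -> tail_bound T ->
  (expect (n := n) th0 (posterior heta c U) <= \sum_(i <oo) (T i)%:E)%E.
Proof.
move=> T0 TP; have mS0 : measurable S0 by exact: measurable_base_region.
have /choice[G GP] : forall z : {i : nat & J i.+1}, exists g : plane R -> R,
    good (tagged z) -> [/\ measurable_fun setT g, forall x, 0 <= g x,
    forall X : n.-tuple (plane R), \sum_(y : n.-tuple bool) likelihood th0 X y *
      Num.sqrt (rprod (tagged z) X y) <= \prod_(l < n) g (tnth X l) &
    (\int[iid (uniform_square (@ltr01 R)) n]_X (\prod_(l < n) g (tnth X l))%:E <=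
      (expR (log_bound eta th0 h S0 n (rep (tagged z)).2))%:E)%E].
  move=> [i j] /=; have [gj|gj] := boolP (good j); last by exists (cst 0).
  have [sr _ _] := repP gj.
  by have [g gP] := cell_majorant heta r0 m0 sub0 h0 mS0 n sr; exists g.
pose g i (j : J i.+1) := G (existT _ i j).
have {}GP i (j : J i.+1) := GP (existT _ i j).
pose F i (X : n.-tuple (plane R)) : R :=
  \sum_(j : J i.+1 | good j) Num.sqrt (cell_odds i) * \prod_(l < n) g i j (tnth X l).
have F0 i X : 0 <= F i X.
  apply: sumr_ge0 => j gj; rewrite mulr_ge0 ?sqrtr_ge0// prodr_ge0// => l _.
  by have [_ + _ _] := GP i j gj; exact.
pose f i (j : J i.+1) (X : n.-tuple (plane R)) : R :=
  if good j then Num.sqrt (cell_odds i) * \prod_(l < n) g i j (tnth X l) else 0.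
have FE i X : (F i X)%:E = (\sum_(j : J i.+1) (f i j X)%:E)%E.
  by rewrite sumEFin /F big_mkcond.
have f0 i j X : 0 <= f i j X.
  rewrite /f; case: ifP => // gj; rewrite mulr_ge0 ?sqrtr_ge0// prodr_ge0// => l _.
  by have [_ + _ _] := GP i j gj; exact.
have mf i j : measurable_fun setT (fun X => (f i j X)%:E).
  apply/measurable_EFinP; rewrite /f; case: (boolP (good j)) => // gj; apply: measurable_funM => //.
  by apply: (@measurable_prod_tnth _ _ R n (fun=> g i j)) => _; have [] := GP i j gj.
have mF i : measurable_fun setT (fun X => (F i X)%:E).
  rewrite (_ : (fun X => _) = fun X => (\sum_(j : J i.+1) (f i j X)%:E)%E).
    by apply: emeasurable_sum => j; exact: mf.
  by apply/funext => X; exact: FE.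
have IF i : (\int[iid (uniform_square (@ltr01 R)) n]_X (F i X)%:E <= (T i)%:E)%E.
  under eq_integral => X _ do rewrite FE.
  rewrite ge0_integral_sum//; last by move=> j X _; rewrite lee_fin.
  have MM : 0 < M%:R ^+ (2 * i.+2) :> R by rewrite exprn_gt0// ltr0n.
  apply: (@le_trans _ _ (\sum_(j : J i.+1) (T i / M%:R ^+ (2 * i.+2))%:E)%E); last first.
    rewrite sumEFin lee_fin sumr_const.
    have -> : #|{: J i.+1}| = (M ^ (2 * i.+2))%N.
      by rewrite !(card_prod, card_tuple, card_ord) mulnn -expnM -expnD -mulnS.
    by rewrite -[leLHS]mulr_natr natrX divfK// gt_eqF.
  apply: lee_sum => j _; rewrite /f; case: (boolP (good j)) => gj; last first.
    by rewrite integral0 lee_fin divr_ge0// ltW.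
  have [mg g0 _ Ig] := GP i j gj; have [sr _ Ur] := repP gj.
  under eq_integral => X _ do rewrite EFinM.
  rewrite ge0_integralZl//; last 2 first.
  - by apply/measurable_EFinP; apply: (@measurable_prod_tnth _ _ R n (fun=> g i j)).
  - by move=> X _; rewrite lee_fin; apply: prodr_ge0 => l _; exact: g0.
  apply: le_trans (lee_wpmul2l _ Ig) _; first by rewrite lee_fin sqrtr_ge0.
  rewrite -EFinM lee_fin ler_pdivlMr// mulrAC; exact: TP.
apply: (@le_trans _ _ (\int[iid (uniform_square (@ltr01 R)) n]_X
    \sum_(i <oo) (F i X)%:E)%E); last first.
  rewrite integral_nneseries//; last by move=> i X _; rewrite lee_fin.
  apply: lee_nneseries => i _; last exact: IF.
  by move=> _; apply: integral_ge0 => X _; rewrite lee_fin.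
have L0 (X : n.-tuple (plane R)) y : 0 <= likelihood th0 X y by apply/ltW; exact: (likelihood_gt0 heta).
have post0 (X : n.-tuple (plane R)) y i : 0 <= post_term heta c X y U i by exact: (post_term_ge0 heta c1 n0 X y).
have sumE X : (\sum_(y : n.-tuple bool)
    likelihood th0 X y * posterior heta c U X y)%R%:E =
    (\sum_(i <oo) \sum_(y : n.-tuple bool)
      (likelihood th0 X y * post_term heta c X y U i)%:E)%E.
  rewrite nneseries_sum; last by move=> y i _; rewrite lee_fin mulr_ge0.
  rewrite -sumEFin; apply: eq_bigr => y _.
  rewrite EFinM (posterior_series heta c1 n0) -nneseriesZl; last by move=> i _; rewrite lee_fin.
  by apply: eq_eseriesr => i _; rewrite EFinM.
rewrite /expect; apply: ge0_le_lower_integral => X; rewrite sumE.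
  by apply: nneseries_ge0 => i _ _; apply: sume_ge0 => y _; rewrite lee_fin mulr_ge0.
apply: lee_nneseries => i; first by move=> _ _; apply: sume_ge0 => y _; rewrite lee_fin mulr_ge0.
move=> _; rewrite sumEFin lee_fin.
apply: (@le_trans _ _ (\sum_(y : n.-tuple bool) likelihood th0 X y *
    \sum_(j : J i.+1 | good j) Num.sqrt (cell_odds i) * Num.sqrt (rprod j X y))).
  apply: ler_sum => y _; rewrite ler_wpM2l//.
  apply: le_trans (le_sqrtr01 (post0 _ _ _) (post_term_le1 heta c1 n0 _ _ _ _)) _.
  apply: le_trans (ler_wsqrtr (post_term_le X y i)) _.
  apply: le_trans (ler_sqrt_sum _ _) _.
    by move=> j gj; rewrite mulr_ge0// rprod_ge0.
  by apply: ler_sum => j gj; rewrite sqrtrM.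
under eq_bigr do rewrite mulr_sumr.
rewrite exchange_big/=; apply: ler_sum => j gj.
have [_ _ + _] := GP i j gj; move=> /(_ X) Gle.
under eq_bigr do rewrite mulrCA.
by rewrite -mulr_sumr ler_wpM2l// sqrtr_ge0.
Qed.

End PosteriorBound.

(** * Asymptotics and exponents *)
Section Asymptotics.
Context {R : realType}.

Lemma near_nat_ge (A : R) : \forall n \near \oo, A <= n%:R.
Proof.
have [A0|A0] := leP A 0; first by near=> n; exact: le_trans A0 _.
exists (Num.truncn A).+1 => // n /= An; apply/ltW.
have /andP[_ +] := truncn_itv (ltW A0).
by move=> /lt_le_trans; apply; rewrite ler_nat.
Unshelve. all: by end_near. Qed.

Lemma near_logen_ge (A : R) : \forall n \near \oo, A <= logen n :> R.
Proof.
near=> n; have n0 : (0 < n)%N by near: n; exact: nbhs_infty_gt.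
rewrite logenE// -[A]expRK; apply: (@le_trans _ _ (ln n%:R)); last by rewrite lerDr.
rewrite ler_ln ?posrE ?expR_gt0 ?ltr0n//; near: n; exact: near_nat_ge.
Unshelve. all: by end_near. Qed.

Lemma logen_le_sqrt n : (0 < n)%N -> logen n <= 2 * Num.sqrt n%:R :> R.
Proof.
move=> n0; have n1 : 0 < n%:R :> R by rewrite ltr0n.
have s0 : 0 < Num.sqrt n%:R :> R by rewrite sqrtr_gt0.
have e : ln (n%:R : R) = 2 * ln (Num.sqrt n%:R).
  by rewrite -{1}(sqr_sqrtr (ltW n1)) lnXn// mulr_natl.
have := expR_ge1Dx (ln (Num.sqrt (n%:R : R))); rewrite lnK ?posrE// logenE// e.
lra.
Qed.

Lemma logen_le_ln n : (0 < n)%N -> 2 <= logen n :> R -> logen n <= 2 * ln n%:R :> R.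
Proof. by move=> n0; rewrite logenE//; lra. Qed.

(** From [ln n <= 2 * sqrt n], itself [ln x < x] at [sqrt n]. *)
Lemma near_logen_small (K d : R) : 0 < d -> \forall n \near \oo, K * logen n <= n%:R * d.
Proof.
move=> d0; near=> n; have n0 : (0 < n)%N by near: n; exact: nbhs_infty_gt.
have n1 : 0 < n%:R :> R by rewrite ltr0n.
have s0 : 0 < Num.sqrt n%:R :> R by rewrite sqrtr_gt0.
have L := logen_le_sqrt n0.
have Ks : 2 * `|K| <= Num.sqrt n%:R * d.
  have q0 : 0 <= 2 * `|K| / d by rewrite divr_ge0 ?mulr_ge0// ltW.
  rewrite -ler_pdivrMr// -(ger0_norm q0) -[leLHS]sqrtr_sqr ler_wsqrtr//; near: n; exact: near_nat_ge.
have L0 : 0 <= logen n :> R by apply: le_trans ler01 (logen_ge1 n0).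
apply: (@le_trans _ _ (`|K| * logen n)); first by rewrite ler_wpM2r// ler_norm.
apply: (@le_trans _ _ (`|K| * (2 * Num.sqrt n%:R))); first by rewrite ler_wpM2l.
have -> : `|K| * (2 * Num.sqrt n%:R) = Num.sqrt n%:R * (2 * `|K|) by ring.
rewrite -[X in X * d](sqr_sqrtr (ltW n1)) expr2 -mulrA.
by rewrite ler_wpM2l// ltW.
Unshelve. all: by end_near. Qed.

End Asymptotics.

Section Approximability.
Context {R : realType}.
Variables (eta : R) (heta : 0 < eta < 1 / 2) (G0 : set (plane R)) (mG0 : measurable G0).

Definition inner_tuple k (w : k.-tuple (plane R)) := forall l, inner_square eta (tnth w l).

(** [G0] is a limit, in area, of hulls of [i.+1] points. *)
Definition approximable i := forall e, 0 < e ->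
  exists2 w : i.+1.-tuple (plane R), inner_tuple w & pr (hull [set` w] `+` G0) <= e.

Lemma pr_setY_le (A : set (plane R)) : measurable A -> pr (A `+` G0) <= pr A + pr G0.
Proof.
move=> mA; have mY : measurable (A `+` G0) by exact: measurableY.
apply: le_trans (prU mA mG0); apply: le_pr => //; first exact: measurableU.
by rewrite setY_def => x [[]|[]]; [left|right].
Qed.

Lemma null_approximable : pr G0 = 0 -> approximable 0.
Proof.
move=> G00 e e0; exists [tuple of [:: (1 / 2, 1 / 2) : plane R]].
  move=> l; rewrite ord1 /inner_square /= !in_itv/=.
  by case/andP: heta => ? ?; split; apply/andP; split; lra.
apply: le_trans (pr_setY_le _) _; first exact: measurable_hull.
by rewrite hull_null// G00 addr0 ltW.
Qed.

(** Finite Krein-Milman; the empty set, which is no hull of [m] points, is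
    approximated by a single point. *)
Lemma polytope_approximable m : (0 < m)%N -> polytopes eta m G0 -> approximable m.-1.
Proof.
case: m => // m _ pG; have [GE|[w GE win]] := polytope_tuple (ltn0Sn m) pG.
  move=> e e0; pose p : plane R := (1 / 2, 1 / 2).
  exists [tuple of nseq m.+1 p].
    move=> l; rewrite (tnth_nth p) nth_nseq; case: ifP => _;
    rewrite /inner_square /= !in_itv/=;
    by case/andP: heta => ? ?; split; apply/andP; split; lra.
  apply: le_trans (pr_setY_le _) _; first exact: measurable_hull.
  rewrite (_ : [set` _] = [set` [:: p]]).
    have -> : pr G0 = 0.
      by have := @hull_null R [::] isT; rewrite GE (_ : [set` _] = set0) ?hull0//;
        apply/seteqP; split.
    by rewrite hull_null// addr0 ltW.
  apply/seteqP; split => x /=; rewrite !inE; last by move=> ->.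
  by move=> /orP[//|]; rewrite mem_nseq => /andP[].
move=> e e0; exists w => //; rewrite -GE setYK.
by have := @hull_null R [::] isT; rewrite (_ : [set` _] = set0) ?hull0 => [->|];
  [exact: ltW|apply/seteqP; split].
Qed.

(** Finitely many positive infima have a positive minimum. *)
Lemma not_approximable_gap s : (forall i, (i < s)%N -> ~ approximable i) ->
  exists2 d, 0 < d & forall i, (i < s)%N -> forall w : i.+1.-tuple (plane R),
    inner_tuple w -> d <= pr (hull [set` w] `+` G0).
Proof.
elim: s => [|s IH] H; first by exists 1.
have [|d d0 dP] := IH; first by move=> i /ltnW; exact: H.
have [e [e0 eP]] : exists e, 0 < e /\ forall w : s.+1.-tuple (plane R),
    inner_tuple w -> e <= pr (hull [set` w] `+` G0).
  have /existsNP[e /not_implyP[e0 eN]] := H s (ltnSn s).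
  exists e; split => // w iw; rewrite leNgt; apply/negP => lt; apply: eN.
  by exists w => //; exact: ltW.
exists (Num.min d e); first by rewrite lt_min d0.
move=> i; rewrite ltnS leq_eqVlt => /orP[/eqP -> w iw|si w iw].
  by rewrite ge_min eP ?orbT.
by rewrite ge_min dP.
Qed.

End Approximability.

Section Exponent.
Context {R : realType}.
Variables (eta : R) (heta : 0 < eta < 1 / 2) (c : R) (c1 : 1 <= c).
Variables (n : nat) (n0 : (0 < n)%N).
Local Notation M := (n ^ 2)%N.
Local Notation h := (mesh eta M).

Let M0 : (0 < M)%N. Proof. by rewrite expn_gt0 n0. Qed.
Let nR : 0 < n%:R :> R. Proof. by rewrite ltr0n. Qed.
Let h0 : 0 <= h. Proof. exact/ltW/mesh_gt0. Qed.

Lemma mesh_scaled : n%:R * h <= n%:R^-1.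
Proof.
have := mesh_le heta M; rewrite natrX => hM.
apply: le_trans (ler_wpM2l (ltW nR) hM) _.
by rewrite expr2 invfM mulrA divff ?mul1r// gt_eqF.
Qed.

(** There are [k ^ 2] strips of probability at most [8 * h], with
    [h <= 1 / n ^ 2]; this is good enough for [k <= n], and for larger [k] the
    trivial bound one suffices. *)
Lemma edge_strips_scaled k (w : k.-tuple (plane R)) :
  n%:R * pr (edge_strips w h) <= 8 * k%:R.
Proof.
have mS : measurable (edge_strips w h) by exact: measurable_edge_strips.
have [kn|nk] := leqP k n; last first.
  apply: (@le_trans _ _ n%:R); first by rewrite ler_piMr// ?pr_le1// ltW.
  have : n%:R <= k%:R :> R by rewrite ler_nat ltnW.
  have : 0 <= k%:R :> R by [].
  lra.
have H : pr (edge_strips w h) <= (k ^ 2)%:R * (8 * h).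
  by rewrite -lee_fin -prE//; exact: uniform_edge_strips.
apply: le_trans (ler_wpM2l (ltW nR) H) _.
rewrite natrX expr2.
have -> : n%:R * (k%:R * k%:R * (8 * h)) = 8 * k%:R * (k%:R * (n%:R * h)) by ring.
rewrite -[leRHS]mulr1 ler_wpM2l ?mulr_ge0//.
apply: (@le_trans _ _ (n%:R * n%:R^-1)); last by rewrite divff// gt_eqF.
by apply: ler_pM => //; [rewrite mulr_ge0// ltW|rewrite ler_nat|exact: mesh_scaled].
Qed.

Variables (th0 : param R) (s : nat) (mG0 : measurable th0.2)
  (w0 : (measurableTypeR R * measurableTypeR R) * s.+1.-tuple (plane R)).
Hypothesis w0_close : pr (hull [set` w0.2] `+` th0.2) <= n%:R^-1.
Local Notation S0 := (base_region eta M th0 w0).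
Hypothesis n_large : 9 / eta <= logen n.

Lemma log_bound_le k (w : k.+1.-tuple (plane R)) :
  log_bound eta th0 h S0 n w <= logen n * (k.+1%:R + s.+1%:R) -
    n%:R * hellinger_rate eta th0 * Num.min (pr (hull [set` w] `+` th0.2)) (pr th0.2).
Proof.
rewrite /log_bound mulrBr -mulrA lerD2r.
case/andP: (heta) => e0 _.
have ei : 0 < eta^-1 by rewrite invr_gt0.
have A := edge_strips_scaled w; have B := edge_strips_scaled w0.2.
have n1 : n%:R^-1 <= 1 :> R by rewrite invf_le1// ler1n.
have C : n%:R * pr (hull [set` w0.2] `+` th0.2) <= 1.
  by apply: le_trans (ler_wpM2l (ltW nR) w0_close) _; rewrite divff// gt_eqF.
have D : pr S0 <= pr (edge_strips w0.2 h) + pr (hull [set` w0.2] `+` th0.2).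
  apply: prU; first exact: measurable_edge_strips.
  by apply: measurableY => //; exact: measurable_hull.
have {}D := ler_wpM2l (ltW nR) D.
have E := le_trans mesh_scaled n1.
have -> : n%:R * (h / eta + (pr (edge_strips w h) + pr S0) / eta) =
  eta^-1 * (n%:R * h + n%:R * pr (edge_strips w h) + n%:R * pr S0) by ring.
have k1 : 1 <= k.+1%:R :> R by rewrite ler1n.
have s1 : 1 <= s.+1%:R :> R by rewrite ler1n.
apply: (@le_trans _ _ (eta^-1 * (9 * (k.+1%:R + s.+1%:R)))).
  by apply: ler_wpM2l; [exact: ltW|lra].
by rewrite mulrA [_ * 9]mulrC ler_wpM2r//; lra.
Qed.

Lemma sqrt_cell_odds i : Num.sqrt (cell_odds c n M s i) * M%:R ^+ (2 * i.+2) <=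
  expR (logen n * (c / 2 * (s.+1%:R - i.+1%:R) + 2 * (i.+1%:R + s.+1%:R) + 4)).
Proof.
have M1 : 0 < M%:R :> R by rewrite ltr0n.
have -> : cell_odds c n M s i =
    (expR (c / 2 * (s.+1%:R - i.+1%:R) * logen n) * (M%:R ^+ s.+2 / M%:R ^+ i.+2)) ^+ 2.
  rewrite /cell_odds -mulf_div model_prior_ratio//.
  have -> : c * (s.+1%:R - i.+1%:R) * logen n =
    c / 2 * (s.+1%:R - i.+1%:R) * logen n + c / 2 * (s.+1%:R - i.+1%:R) * logen n by field.
  rewrite expRD exprMn -expr2; congr (_ * _).
  by rewrite expr_div_n -!exprM ![(_.+2 * 2)%N]mulnC !exprVn invrK mulrC.
rewrite sqrtr_sqr ger0_norm; last by rewrite mulr_ge0 ?expR_ge0// divr_ge0// exprn_ge0.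
have -> : M%:R ^+ (2 * i.+2) = M%:R ^+ i.+2 * M%:R ^+ i.+2 :> R.
  by rewrite mul2n -addnn exprD.
have Mi : M%:R ^+ i.+2 != 0 :> R by rewrite expf_neq0// gt_eqF.
rewrite -[leLHS]mulrA [X in expR _ * X](_ : _ = M%:R ^+ (s.+2 + i.+2)); last first.
  by rewrite exprD; move: (M%:R ^+ s.+2) (M%:R ^+ i.+2) Mi => q r r0; field.
have -> : M%:R ^+ (s.+2 + i.+2) = expR ((s.+2 + i.+2)%:R * 2 * ln n%:R) :> R.
  by rewrite -[X in expR X]mulrA [RHS]expRM_natl [expR (2 * _)]expRM_natl lnK ?posrE// natrX.
rewrite -expRD ler_expR.
have e : (s.+2 + i.+2)%:R * 2 = 2 * (i.+1%:R + s.+1%:R) + 4 :> R.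
  by rewrite natrD -!(natr1 (_.+1)); ring.
have X0 : 0 <= 2 * (i.+1%:R + s.+1%:R) + 4 :> R by rewrite addr_ge0// mulr_ge0// addr_ge0.
have Ln : ln n%:R <= logen n :> R by rewrite logenE// lerDr.
have := ler_wpM2l X0 Ln; rewrite e.
move: (i.+1%:R) (s.+1%:R) (ln n%:R) (logen n) => k k' l L; lra.
Qed.

(** The square root of the prior odds and the number of cells are powers of [n]
    and [exp L]; the contribution of the strips is at most [9 (k + s) / eta],
    absorbed in [L * (k + s)] for [n] large. *)
Lemma tail_le_exponent i (w : i.+1.-tuple (plane R)) :
  Num.sqrt (cell_odds c n M s i) * M%:R ^+ (2 * i.+2) * expR (log_bound eta th0 h S0 n w) <=
  expR (logen n * (c / 2 * (s.+1%:R - i.+1%:R) + 5 * (i.+1%:R + s.+1%:R)) -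
    n%:R * hellinger_rate eta th0 * Num.min (pr (hull [set` w] `+` th0.2)) (pr th0.2)).
Proof.
have B := log_bound_le w; rewrite -ler_expR in B.
apply: le_trans (ler_pM _ (expR_ge0 _) (sqrt_cell_odds i) B) _.
  by rewrite mulr_ge0 ?sqrtr_ge0// exprn_ge0.
rewrite -expRD ler_expR addrA lerD2r -mulrDr ler_wpM2l//.
  exact: le_trans ler01 (logen_ge1 n0).
have k1 : 1 <= i.+1%:R :> R by rewrite ler1n.
have s1 : 1 <= s.+1%:R :> R by rewrite ler1n.
lra.
Qed.

End Exponent.

(** * Choice of the constants *)
Section ExponentCases.
Context {R : realType}.
Variables (m k ks : nat) (L g delta p n eps d : R).
Hypotheses (m0 : (0 < m)%N) (k0 : (0 < k)%N) (ks0 : (0 < ks)%N) (ksm : (ks <= m)%N).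
Hypotheses (L0 : 0 <= L) (n0 : 0 <= n) (g0 : 0 <= g) (p0 : 0 <= p).
Local Notation c := (40 * (m%:R + 1) : R).
Local Notation lhs := (L * (c / 2 * (ks%:R - k%:R) + 5 * (k%:R + ks%:R)) -
  n * g * Num.min delta p).

Let m1 : 1 <= m%:R :> R. Proof. by rewrite ler1n. Qed.
Let k1 : 1 <= k%:R :> R. Proof. by rewrite ler1n. Qed.
Let ks1 : 1 <= ks%:R :> R. Proof. by rewrite ler1n. Qed.
Let ksmR : ks%:R <= m%:R :> R. Proof. by rewrite ler_nat. Qed.

Let from_prior : 0 <= delta ->
  c / 2 * (ks%:R - k%:R) + 5 * (k%:R + ks%:R) <= - (m%:R + k%:R) ->
  lhs <= - ((m%:R + k%:R) * L).
Proof.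
move=> d0 H; have := ler_wpM2l L0 H.
have : 0 <= n * g * Num.min delta p by rewrite !mulr_ge0// le_min d0.
by move: (Num.min delta p) => mn; lra.
Qed.

Lemma exponent_degenerate : 0 <= delta -> ks = 1%N -> (2 < k)%N ->
  lhs <= - ((m%:R + k%:R) * L).
Proof.
move=> d0 kse k3; apply: from_prior => //; rewrite kse.
have k3' : 3 <= k%:R :> R by rewrite (ler_nat R 3).
have : 0 <= m%:R * (k%:R - 3) :> R by rewrite mulr_ge0// subr_ge0.
have := m1; have := k1; have := ks1; have := ksmR; lra.
Qed.

Lemma exponent_many : 0 <= delta -> (2 * m <= k)%N -> lhs <= - ((m%:R + k%:R) * L).
Proof.
move=> d0 mk; apply: from_prior => //.
have mk' : 2 * m%:R <= k%:R :> R by rewrite -natrM ler_nat.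
have : 0 <= m%:R * (k%:R - 2 * m%:R) :> R by rewrite mulr_ge0// subr_ge0.
have : 0 <= m%:R * (m%:R - ks%:R) :> R by rewrite mulr_ge0// subr_ge0.
have : 0 <= m%:R * m%:R :> R by rewrite mulr_ge0.
have := m1; have := k1; have := ks1; have := ksmR; lra.
Qed.

Lemma exponent_middle : (ks <= k)%N -> (k < 2 * m)%N ->
  eps <= delta -> eps <= p -> 18 * m%:R * L <= n * g * eps ->
  lhs <= - ((m%:R + k%:R) * L).
Proof.
move=> kk km ed ep H.
have me : eps <= Num.min delta p by rewrite le_min ed.
have : n * g * eps <= n * g * Num.min delta p by rewrite ler_wpM2l// mulr_ge0.
move: (Num.min delta p) => mn hm.
have km' : k%:R <= 2 * m%:R :> R by rewrite -natrM ler_nat ltnW.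
have kk' : ks%:R <= k%:R :> R by rewrite ler_nat.
have X : c / 2 * (ks%:R - k%:R) + 5 * (k%:R + ks%:R) + (m%:R + k%:R) <= 18 * m%:R.
  have : 0 <= m%:R * (k%:R - ks%:R) :> R by rewrite mulr_ge0// subr_ge0.
  have := m1; have := k1; have := ks1; have := ksmR; lra.
have := ler_wpM2l L0 X; lra.
Qed.

Lemma exponent_few : (k < ks)%N -> d <= delta -> d <= p ->
  (20 * (m%:R + 1) * m%:R + 12 * m%:R) * L <= n * g * d ->
  lhs <= - ((m%:R + k%:R) * L).
Proof.
move=> kk ed ep H.
have me : d <= Num.min delta p by rewrite le_min ed.
have : n * g * d <= n * g * Num.min delta p by rewrite ler_wpM2l// mulr_ge0.
move: (Num.min delta p) => mn hm.
have kk' : k%:R <= ks%:R :> R by rewrite ler_nat ltnW.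
have X : c / 2 * (ks%:R - k%:R) + 5 * (k%:R + ks%:R) + (m%:R + k%:R) <=
  20 * (m%:R + 1) * m%:R + 12 * m%:R.
  have : 0 <= (m%:R + 1) * (m%:R - (ks%:R - k%:R)) :> R.
    by rewrite mulr_ge0//; have := m1; have := k1; have := ks1; have := ksmR; lra.
  have := m1; have := k1; have := ks1; have := ksmR; lra.
have := ler_wpM2l L0 X; lra.
Qed.

End ExponentCases.

(** [L >= 1] and [L >= ln n], so a geometric series of ratio at most one half is
    left. *)
Lemma tail_series (R : realType) (m n : nat) : (0 < n)%N ->
  (\sum_(i <oo) (expR (- ((m%:R + i.+1%:R) * logen n)) : R)%:E <=
    (expR (- (m%:R * ln n%:R)))%:E)%E.
Proof.
move=> n0; have L1 := logen_ge1 n0 : 1 <= logen n :> R.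
have Ln : ln n%:R <= logen n :> R by rewrite logenE// lerDr.
have -> : (\sum_(i <oo) (expR (- ((m%:R + i.+1%:R) * logen n)) : R)%:E =
    (expR (- (m%:R * logen n)))%:E * \sum_(i <oo) (expR (- (i.+1%:R * logen n)))%:E)%E.
  rewrite -nneseriesZl; last by move=> i _; rewrite lee_fin expR_ge0.
  by apply: eq_eseriesr => i _; rewrite -EFinM -expRD; congr (expR _)%:E; ring.
apply: (@le_trans _ _ ((expR (- (m%:R * logen n)))%:E * 1)%E).
  apply: lee_wpmul2l; first by rewrite lee_fin expR_ge0.
  apply: (@geometric_series_le1 R (fun i => expR (- (i.+1%:R * logen n)))) => i.
    exact: expR_ge0.
  apply: le_trans (expR_half i.+1); rewrite ler_expR lerN2 ler_peMr//.
by rewrite mule1 lee_fin ler_expR lerN2 ler_wpM2l.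
Qed.

Lemma far_posterior (R : realType) (eta : R) (heta : 0 < eta < 1 / 2) (xi0 rho0 : R)
    (m : nat) (G0 : set (plane R)) : (0 < m)%N -> Theta eta m (xi0, rho0, G0) ->
  \forall n \near \oo,
    (expect (n := n) (xi0, rho0, G0)
       (posterior heta (40 * (m%:R + 1))
          [set th | ((36 / hellinger_rate eta (xi0, rho0, G0) * (m%:R * ln n%:R / n%:R))%:E
                     < area (th.2 `+` G0))%E])
     <= (expR (- (m%:R * ln n%:R)))%:E)%E.
Proof.
move=> m0 [/= xiI rhoI ne pG]; set th0 := (xi0, rho0, G0); set g := hellinger_rate eta th0.
have r0 : rates_in eta th0 by [].
have [e0 e1] := andP heta.
have [[sG GE] Gsq _] := pG.
have mG0 : measurable G0 by rewrite GE; exact: measurable_hull.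
have g0 : 0 < g.
  rewrite /g /hellinger_rate /= mulr_gt0// divr_gt0// exprn_gt0// divr_gt0//.
  by rewrite normr_gt0 subr_eq0.
(* [s.+1] is the least number of points that approximate [G0]. *)
pose Ap i := `[< approximable eta G0 i >].
have exA : exists i, Ap i by exists m.-1; apply/asboolP; exact: polytope_approximable.
case: (ex_minnP exA) => s /asboolP sA smin.
have sm : (s < m)%N.
  have : (s <= m.-1)%N by apply: smin; apply/asboolP; exact: polytope_approximable.
  by case: (m) m0.
have notA i : (i < s)%N -> ~ approximable eta G0 i.
  move=> si iA; have : (s <= i)%N by apply: smin; exact/asboolP.
  by rewrite leqNgt si.
have [d d0 dP] := not_approximable_gap notA.
pose c : R := 40 * (m%:R + 1).
have c1 : 1 <= c by rewrite /c; have : 0 <= m%:R :> R by []; lra.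
have pG0 : 0 <= pr G0 by exact: pr_ge0.
have dp : pr G0 != 0 -> 0 < Num.min d (pr G0).
  by move=> pn; rewrite lt_min d0 lt_neqAle eq_sym pn.
have near_pos (K e : R) : (pr G0 != 0 -> 0 < e) ->
    \forall n \near \oo, pr G0 != 0 -> K * logen n <= n%:R * (g * e).
  move=> e0'; have [_|pn] := boolP (pr G0 == 0); first exact: nearW.
  have := @near_logen_small R K (g * e) (mulr_gt0 g0 (e0' pn)).
  by apply: filterS.
have pG0_gt0 : pr G0 != 0 -> 0 < pr G0 by move=> pn; rewrite lt_neqAle eq_sym pn.
have near_area := near_pos (36 * m%:R) _ pG0_gt0.
have near_few := near_pos (20 * (m%:R + 1) * m%:R + 12 * m%:R) _ dp.
near=> n.
have n0 : (0 < n)%N by near: n; exact: nbhs_infty_gt.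
have nR : 0 < n%:R :> R by rewrite ltr0n.
have M0 : (0 < n ^ 2)%N by rewrite expn_gt0 n0.
have L1 := logen_ge1 n0 : 1 <= logen n :> R.
have Lbig : 9 / eta <= logen n by near: n; exact: near_logen_ge.
have L2 : 2 <= logen n :> R by near: n; exact: near_logen_ge.
have [w win wclose] : exists2 w : s.+1.-tuple (plane R), inner_tuple eta w &
    pr (hull [set` w] `+` G0) <= n%:R^-1 by apply: sA; rewrite invr_gt0.
pose w0 : (measurableTypeR R * measurableTypeR R) * s.+1.-tuple (plane R) :=
  ((xi0, rho0), w).
have sw0 : draws_in eta w0 by [].
set eps := 36 / g * (m%:R * ln n%:R / n%:R).
have lnn := logen_le_ln n0 L2.
have eps0 : 0 <= eps.
  rewrite /eps mulr_ge0 ?divr_ge0 ?mulr_ge0 ?ln_ge0 ?ler1n//; exact: ltW.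
have ngeps : n%:R * g * eps = 36 * (m%:R * ln n%:R).
  by rewrite /eps; field; rewrite !gt_eqF.
set U := mkset _.
apply: le_trans (tail_series R m n0).
apply: (@expect_posterior_le R eta heta c c1 n n0 (n ^ 2) M0 th0 r0 mG0 Gsq s w0 sw0 erefl U).
  by move=> i; exact: expR_ge0.
move=> i wi [_ /= wi_in] Ui.
have := @tail_le_exponent R eta heta c c1 n n0 th0 s mG0 w0 wclose Lbig i wi.2.
move=> /le_trans; apply.
rewrite ler_expR -/g /=.
have mw : measurable (hull [set` wi.2] `+` G0).
  by apply: measurableY => //; exact: measurable_hull.
have epsd : eps < pr (hull [set` wi.2] `+` G0).
  rewrite -lte_fin; apply: lt_le_trans Ui _; apply: area_le_pr => // x.
  rewrite setY_def => -[[+ _]|[+ _]]; last by move=> /Gsq/(inner_square_unit heta).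
  by move=> /(hull_inner wi_in)/(inner_square_unit heta).
have delta0 := le_trans eps0 (ltW epsd).
have L0 : 0 <= logen n :> R by exact: le_trans L1.
have gn0 := ltW g0; have nn0 := ltW nR.
have [pz|pn] := eqVneq (pr G0) 0.
  have s0 : s = 0%N.
    apply/eqP; rewrite -leqn0; apply: smin; apply/asboolP; exact: null_approximable.
  apply: exponent_degenerate => //; first by rewrite s0.
  rewrite ltnNge; apply/negP => k2.
  have := pr_setY_le mG0 (measurable_hull wi.2).
  rewrite hull_null ?size_tuple// pz addr0 leNgt.
  by rewrite (le_lt_trans eps0 epsd).
have epsp : eps <= pr G0.
  rewrite -(ler_pM2l (mulr_gt0 nR g0)) ngeps.
  apply: (@le_trans _ _ (36 * m%:R * logen n)).
    by rewrite -mulrA !ler_wpM2l// logenE// lerDr.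
  by rewrite -[leRHS]mulrA; move: pn; near: n.
have [k2|k2] := leqP (2 * m) i.+1; first exact: exponent_many.
have [ksk|kks] := leqP s.+1 i.+1.
  apply: (@exponent_middle R m i.+1 s.+1 _ _ _ _ _ eps) => //; first exact: ltW.
  have -> : 18 * m%:R * logen n = 36 * (m%:R * (logen n / 2)) :> R by field.
  by rewrite ngeps !ler_wpM2l// ler_pdivrMr// mulrC.
apply: (@exponent_few R m i.+1 s.+1 _ _ _ _ _ (Num.min d (pr G0))) => //.
- by apply: le_trans (dP i _ wi.2 wi_in) => //; rewrite ge_min lexx.
- by rewrite ge_min lexx orbT.
- by rewrite -[leRHS]mulrA; move: pn; near: n.
Unshelve. all: by end_near. Qed.

Theorem theorem3p27 (R : realType) (eta : R) (heta : 0 < eta < 1 / 2)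
    (xi0 rho0 : R) :
  exists C1 C2 : R, [/\ 0 < C1, 0 < C2 &
    forall m : nat, (0 < m)%N ->
    exists2 c : R, 0 < c &
    forall Gamma0 : set (plane R), Theta eta m (xi0, rho0, Gamma0) ->
    \forall n \near \oo,
      (expect (n := n) (xi0, rho0, Gamma0)
         (posterior heta c
            [set th | ((C1 * (m%:R * ln n%:R / n%:R))%:E
                       < area (th.2 `+` Gamma0))%E])
       <= (C2 * expR (- (m%:R * ln n%:R / C2)))%:E)%E].
Proof.
(* Equal rates are excluded by [Theta], and would make the constant infinite. *)
have [<-|ne] := eqVneq xi0 rho0.
  exists 1, 1; split => // m m0; exists 1 => // G0 [/= _ _].
  by rewrite eqxx.
have [e0 _] := andP heta.
have g0 : 0 < hellinger_rate eta (xi0, rho0, set0).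
  rewrite /hellinger_rate /= mulr_gt0// divr_gt0// exprn_gt0// divr_gt0//.
  by rewrite normr_gt0 subr_eq0.
exists (36 / hellinger_rate eta (xi0, rho0, set0)), 1; split => //; first exact: divr_gt0.
move=> m m0; exists (40 * (m%:R + 1)); first by rewrite mulr_gt0// ltr_pwDr.
move=> G0 G0T; have := far_posterior heta m0 G0T.
by apply: filterS => n; rewrite mul1r divr1.
Qed.
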